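(* Let $\mathfrak M$ be a weight matrix such that $m_k^{1/k}\to\infty$ for all $\mathbf M\in\mathfrak M$. If $F:\Omega_1\to\Omega_2$ is a real analytic mapping between open sets $\Omega_j\subseteq\mathbb{R}^{n_j}$, $j=1,2$, then $u\circ F\in\mathcal{E}^{[\mathfrak M]}(\Omega_1)$ for every $u\in\mathcal{E}^{[\mathfrak M]}(\Omega_2)$, i.e. the pullback $F^*:\mathcal{E}^{[\mathfrak M]}(\Omega_2)\to\mathcal{E}^{[\mathfrak M]}(\Omega_1)$ is well defined (both in the Roumieu case $[\mathfrak M]=\{\mathfrak M\}$ and in the Beurling case $[\mathfrak M]=(\mathfrak M)$).
   Context: A weight sequence is a sequence $\mathbf M=(M_k)_{k\in\mathbb N}$ with $M_0=1$, such that $\mu_k:=M_k/M_{k-1}$ satisfies $1\le\mu_1\le\mu_2\le\cdots$, and $M_k^{1/k}\to\infty$; write $m_k=M_k/k!$. A weight matrix is a family of weight sequences totally ordered by the pointwise order. For open $\Omega\subseteq\mathbb R^n$, $\mathcal E^{\{\mathfrak M\}}(\Omega)$ is the set of $f\in C^\infty(\Omega)$ such that for every relatively compact open $V\subseteq\Omega$ there exist $\mathbf M\in\mathfrak M$ and $\rho>0$ with $\sup_{x\in V,\alpha\in\mathbb N^n}|\partial^\alpha f(x)|/(\rho^{|\alpha|}M_{|\alpha|})<\infty$; $\mathcal E^{(\mathfrak M)}(\Omega)$ is the set of $f\in C^\infty(\Omega)$ such that this supremum is finite for every relatively compact open $V\subseteq\Omega$, every $\mathbf M\in\mathfrak M$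 and every $\rho>0$. *)

(* Defs.v *)
From HB Require Import structures.
From mathcomp Require Import all_boot all_order all_algebra.
From mathcomp Require Import all_classical all_reals all_analysis.
Set Implicit Arguments. Unset Strict Implicit. Unset Printing Implicit Defensive.
Import Order.TTheory GRing.Theory Num.Theory.
Import numFieldNormedType.Exports.
Local Open Scope classical_set_scope.
Local Open Scope ring_scope.

Section Defs.
Variable R : realType.

Definition weight_sequence (M : nat -> R) : Prop :=
  [/\ M 0%N = 1,
      1 <= M 1%N / M 0%N,
      (forall k : nat, M k.+1 / M k <= M k.+2 / M k.+1) &
      (fun k : nat => M k `^ (k%:R)^-1) @ \oo --> +oo].

Definition small_m (M : nat -> R) (k : nat) : R := M k / (k`!)%:R.

Definition weight_matrix (W : set (nat -> R)) : Prop :=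
  (forall M, W M -> weight_sequence M) /\
  (forall M N, W M -> W N -> (forall k, M k <= N k) \/ (forall k, N k <= M k)).

Definition evec (n : nat) (i : 'I_n) : 'rV[R]_n := delta_mx 0 i.

Definition pderiv (n : nat) (i : 'I_n) (f : 'rV[R]_n -> R) : 'rV[R]_n -> R :=
  fun x => 'D_(evec i) f x.

Fixpoint ipderiv (n : nat) (s : seq 'I_n) (f : 'rV[R]_n -> R) : 'rV[R]_n -> R :=
  match s with
  | [::] => f
  | i :: s' => pderiv i (ipderiv s' f)
  end.

Definition mindex (n : nat) := {ffun 'I_n -> nat}.
Definition mlen (n : nat) (a : mindex n) : nat := (\sum_(i < n) a i)%N.

Definition dalpha (n : nat) (a : mindex n) (f : 'rV[R]_n -> R) : 'rV[R]_n -> R :=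
  foldr (fun i g => iter (a i) (pderiv i) g) f (enum 'I_n).

Definition smooth_on (n : nat) (Omega : set 'rV[R]_n) (f : 'rV[R]_n -> R) : Prop :=
  forall (s : seq 'I_n) (x : 'rV[R]_n), Omega x ->
    (forall i : 'I_n, derivable (ipderiv s f) x (evec i)) /\
    {for x, continuous (ipderiv s f)}.

Definition rel_compact_open_in (n : nat) (V Omega : set 'rV[R]_n) : Prop :=
  [/\ open V, compact (closure V) & closure V `<=` Omega].

Definition roumieu_class (W : set (nat -> R)) (n : nat) (Omega : set 'rV[R]_n)
    (f : 'rV[R]_n -> R) : Prop :=
  smooth_on Omega f /\
  forall V, rel_compact_open_in V Omega ->
    exists M, W M /\ exists rho : R, 0 < rho /\ exists C : R,
      forall (x : 'rV[R]_n) (a : mindex n), V x ->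
        `|dalpha a f x| / (rho ^+ mlen a * M (mlen a)) <= C.

Definition beurling_class (W : set (nat -> R)) (n : nat) (Omega : set 'rV[R]_n)
    (f : 'rV[R]_n -> R) : Prop :=
  smooth_on Omega f /\
  forall V, rel_compact_open_in V Omega ->
    forall M, W M -> forall rho : R, 0 < rho -> exists C : R,
      forall (x : 'rV[R]_n) (a : mindex n), V x ->
        `|dalpha a f x| / (rho ^+ mlen a * M (mlen a)) <= C.

Definition mono (n : nat) (a : mindex n) (x x0 : 'rV[R]_n) : R :=
  \prod_(i < n) (x 0 i - x0 0 i) ^+ a i.

Definition hom_part (n : nat) (c : mindex n -> R) (x0 x : 'rV[R]_n) (k : nat) : R :=
  \sum_(b : {ffun 'I_n -> 'I_k.+1} | (\sum_(i < n) (b i : nat))%N == k)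
     c [ffun i => (b i : nat)] * mono [ffun i => (b i : nat)] x x0.

Definition abs_hom_part (n : nat) (c : mindex n -> R) (x0 x : 'rV[R]_n) (k : nat) : R :=
  \sum_(b : {ffun 'I_n -> 'I_k.+1} | (\sum_(i < n) (b i : nat))%N == k)
     `|c [ffun i => (b i : nat)]| * `|mono [ffun i => (b i : nat)] x x0|.

Definition analytic_at (n : nat) (f : 'rV[R]_n -> R) (x0 : 'rV[R]_n) : Prop :=
  exists (c : mindex n -> R) (r : R), 0 < r /\
    forall x, ball x0 r x ->
      (exists B : R, forall N, \sum_(k < N) abs_hom_part c x0 x k <= B) /\
      (fun N => \sum_(k < N) hom_part c x0 x k) @ \oo --> f x.

Definition real_analytic_on (n : nat) (Omega : set 'rV[R]_n) (f : 'rV[R]_n -> R) : Prop :=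
  forall x0, Omega x0 -> analytic_at f x0.

Definition real_analytic_map_on (n1 n2 : nat) (Omega : set 'rV[R]_n1)
    (F : 'rV[R]_n1 -> 'rV[R]_n2) : Prop :=
  forall j : 'I_n2, real_analytic_on Omega (fun x => F x 0 j).

End Defs.

(* Main.v *)
Require Import Defs.
From HB Require Import structures.
From mathcomp Require Import all_boot all_order all_algebra.
From mathcomp Require Import all_classical all_reals all_analysis.
From mathcomp Require Import ring lra zify.
Set Implicit Arguments. Unset Strict Implicit. Unset Printing Implicit Defensive.
Import Order.TTheory GRing.Theory Num.Theory.
Import numFieldNormedType.Exports.
Local Open Scope classical_set_scope.
Local Open Scope ring_scope.

(** The ratio mu_k = M_k / M_(k-1) dominates M_k^(1/k), so the hypothesis on m
    forces mu_k / k -> oo.  Hence for every e > 0 the sequence M can be replaced,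
    up to a constant factor, by some N >= M with (k+1) N_k <= e N_(k+1).  If
    |d^s F_j| <= K A^|s| |s|! and |d^t u| <= C rho^|t| N_|t|, the chain rule and
    the Leibniz rule propagate, by induction on |s| and without any Faa di Bruno
    formula, the bound
      |d^s ((d^t u) o F)| <= C L^|s| rho^|t| N_(|t|+|s|)
    as soon as 4 e A <= L and 2 n2 K A rho <= L.  In the Roumieu case e = 1 and L
    is large; in the Beurling case L is given and e, rho are chosen small.  The
    bounds on F, locally uniform hence uniform on compact sets, come from
    differentiating its power series term by term. *)

(** * Differential calculus with partial derivatives *)

(** Log-convexity and M_0 = 1 give M_k <= mu_k^k; with k^k <= k! e^k this yields m_k^(1/k) <= e mu_k
    / k. So mu_k / k is large, but only eventually, whereas the induction needs the growth
    inequality at every index: hence N instead of M. What the growth pays for is the factorial in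
    the derivatives of F. In a Leibniz term with r+1 derivatives on F_j, the number C(q+r,q) r! is
    the product (q+1)...(q+r); each factor is absorbed by raising the index of N once, at the price
    e. The leftover r+1 <= 2^r turns e^r into (2e)^r, so 4 e A <= L makes the Leibniz sum geometric
    of ratio 1/2, with total at most 2. The second condition on L then pays for this 2, the n2 terms
    of the chain rule, and K A rho. Derivatives are indexed by lists of directions, since the
    inductions remove one derivative at a time. Smoothness is stated through partial derivatives
    only, so differentiability and the symmetry of mixed derivatives have to be deduced from
    continuity of the partials. *)

Section Calculus.
Variable R : realType.

Lemma is_derive_line (V : normedModType R) (f : V -> R) (x v : V) (t : R) :
  derivable f (x + t *: v) v ->
  is_derive t 1 (fun s => f (x + s *: v)) ('D_v f (x + t *: v)).
Proof.
move=> df.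
have E : (fun h : R => h^-1 *: (((fun s => f (x + s *: v)) \o shift t) (h *: 1)
            - f (x + t *: v)))
       = (fun h => h^-1 *: ((f \o shift (x + t *: v)) (h *: v) - f (x + t *: v))).
  apply/funext => h /=; congr (_ *: (f _ - _)).
  by rewrite [h *: 1]mulr1 scalerDl addrCA.
by split; rewrite /derivable /derive E.
Qed.

Lemma mvt_origin (phi dphi : R -> R) (h : R) :
  (forall t : R, `|t| <= `|h| -> is_derive t 1 phi (dphi t)) ->
  exists2 t, `|t| <= `|h| & phi h - phi 0 = dphi t * h.
Proof.
move=> dp.
have cont (a b : R) : (forall t, a <= t <= b -> `|t| <= `|h|) ->
    {within `[a, b], continuous phi}.
  move=> ab; apply: derivable_within_continuous => t; rewrite in_itv/= => /ab tb.
  by have [] := dp _ tb.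
have [h0|h0] := leP 0 h.
  have ab t : 0 <= t <= h -> `|t| <= `|h|.
    by move=> /andP[t0 th]; rewrite !ger0_norm.
  have [||t] := @MVT_segment _ phi dphi 0 h h0.
  - by move=> t; rewrite in_itv/= => /andP[/ltW t0 /ltW th]; apply: dp; rewrite ab// t0.
  - exact: cont.
  - by rewrite in_itv/= subr0 => /ab th ->; exists t.
have ab t : h <= t <= 0 -> `|t| <= `|h|.
  by move=> /andP[t0 th]; rewrite !ler0_norm ?lerN2 // ltW.
have [||t] := @MVT_segment _ phi dphi h 0 (ltW h0).
- by move=> t; rewrite in_itv/= => /andP[/ltW t0 /ltW th]; apply: dp; rewrite ab// t0.
- exact: cont.
- rewrite in_itv/= sub0r => /ab th E; exists t => //.
  by rewrite -opprB E mulrN opprK.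
Qed.

Lemma mvt_line (V : normedModType R) (f : V -> R) (x v : V) (h : R) :
  (forall t, `|t| <= `|h| -> derivable f (x + t *: v) v) ->
  exists2 t, `|t| <= `|h| & f (x + h *: v) - f x = 'D_v f (x + t *: v) * h.
Proof.
move=> df.
have [|t th] := @mvt_origin (fun s => f (x + s *: v)) (fun s => 'D_v f (x + s *: v)) h.
  by move=> t /df; exact: is_derive_line.
by rewrite scale0r addr0 => E; exists t.
Qed.

(** The mean value theorem is applied along [v] to the increment of [f] in direction [h *: w], then
    along [w] to the derivative. The left side is symmetric in [v] and [w], which is what makes the
    two mixed derivatives comparable. *)
Lemma second_difference (V : normedModType R) (f : V -> R) (x v w : V) (h : R) :
  (forall s t, `|s| <= `|h| -> `|t| <= `|h| ->
     derivable f (x + s *: v + t *: w) v /\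
     derivable ('D_v f) (x + s *: v + t *: w) w) ->
  exists s t, [/\ `|s| <= `|h|, `|t| <= `|h| &
    f (x + h *: v + h *: w) - f (x + h *: v) - (f (x + h *: w) - f x)
    = 'D_w ('D_v f) (x + s *: v + t *: w) * h * h].
Proof.
move=> df.
have z0 : `|0 : R| <= `|h| by rewrite normr0.
have [|s sh] := @mvt_origin
    (fun s => f ((x + h *: w) + s *: v) - f (x + s *: v))
    (fun s => 'D_v f ((x + h *: w) + s *: v) - 'D_v f (x + s *: v)) h.
  move=> s sh; apply: is_deriveB; apply: is_derive_line.
    by rewrite addrAC; apply: (df _ _ sh (lexx _)).1.
  by have [+ _] := df _ _ sh z0; rewrite scale0r addr0.
rewrite !scale0r !addr0 => E.
have [|t th E2] := @mvt_line _ ('D_v f) (x + s *: v) w h.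
  by move=> t th; have [] := df _ _ sh th.
exists s, t; split => //.
rewrite -E2 -[x + s *: v + _]addrAC -E [x + h *: w + _]addrAC.
by move: (f _) (f (x + h *: v)) (f (x + h *: w)) (f x) => a b c e; ring.
Qed.

(** The two points may differ: in Schwarz's theorem the two orders of differentiation produce
    unrelated intermediate points. *)
Lemma eq_of_near_coincidence (V : normedModType R) (f g : V -> R) (x : V) :
  {for x, continuous f} -> {for x, continuous g} ->
  (forall d, 0 < d -> exists p q, [/\ ball x d p, ball x d q & f p = g q]) ->
  f x = g x.
Proof.
move=> cf cg fg; apply/eqP; rewrite -subr_eq0 -normr_le0.
apply/ler_addgt0Pr => e e0; rewrite add0r.
have e20 : 0 < e / 2 by rewrite divr_gt0.
have /nbhs_ballP[d /= d0 dO] :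
    \forall y \near x, `|f x - f y| <= e / 2 /\ `|g x - g y| <= e / 2.
  by apply: filterI; [move/cvgrPdist_le : cf|move/cvgrPdist_le : cg]; exact.
have [p [q [/dO[xp _] /dO[_ xq] pq]]] := fg _ d0.
rewrite [e]splitr -(subrKA (f p)).
by rewrite (le_trans (ler_normD _ _))// lerD// pq distrC.
Qed.

Lemma schwarz (V : normedModType R) (O : set V) (f : V -> R) (v w : V) (x : V) :
  open O -> O x ->
  (forall y, O y -> [/\ derivable f y v, derivable f y w,
     derivable ('D_v f) y w & derivable ('D_w f) y v]) ->
  {for x, continuous ('D_w ('D_v f))} -> {for x, continuous ('D_v ('D_w f))} ->
  'D_w ('D_v f) x = 'D_v ('D_w f) x.
Proof.
move=> oO Ox df c1 c2; apply: eq_of_near_coincidence c1 c2 _ => d d0.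
have /nbhs_ballP[r /= r0 rO] : nbhs x O by exact: open_nbhs_nbhs.
pose m := Num.min d r.
have m0 : 0 < m by rewrite lt_min d0.
(* With [h = m / 2 / N], every displacement [s *: v + t *: w] has norm at most [m / 2]; the summand
   1 keeps [N] positive when [v] and [w] vanish. *)
pose N : R := (`|v| : R) + (`|w| : R) + 1.
have N0 : 0 < N by apply: ltr_wpDl; [exact: addr_ge0|exact: ltr01].
pose h := m / 2 / N.
have h0 : 0 < h by rewrite !divr_gt0.
have B s t : `|s| <= `|h| -> `|t| <= `|h| -> ball x m (x + s *: v + t *: w).
  rewrite (gtr0_norm h0) => sh th; rewrite -ball_normE /ball_/= -addrA opprD addNKr.
  rewrite normrN (le_lt_trans (ler_normD _ _))// !normrZ.
  apply: (@le_lt_trans _ _ (h * `|v| + h * `|w|)).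
    by rewrite lerD// ler_wpM2r.
  rewrite -mulrDr; apply: (@le_lt_trans _ _ (h * N)).
    by rewrite (ler_wpM2l (ltW h0))// /N lerDl.
  by rewrite divfK ?gt_eqF// ltr_pdivrMr// ltr_pMr// ltr1n.
have Bd y : ball x m y -> ball x d y by apply: le_ball; rewrite ge_min lexx.
have BO y : ball x m y -> O y.
  by move=> xy; apply: rO; apply: le_ball xy; rewrite ge_min lexx orbT.
have [|s [t [sh th E1]]] := @second_difference _ f x v w h.
  by move=> s t sh th; have [] := df _ (BO _ (B s t sh th)).
have [|s' [t' [sh' th' E2]]] := @second_difference _ f x w v h.
  by move=> s' t' sh' th'; have := B t' s' th' sh'; rewrite addrAC => /BO/df[].
exists (x + s *: v + t *: w), (x + s' *: w + t' *: v); split.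
- exact/Bd/B.
- by rewrite addrAC; exact/Bd/B.
have hn0 : h != 0 by rewrite gt_eqF.
move: ('D_w _ _) ('D_v ('D_w f) _) E1 E2 => a b; rewrite [x + h *: w + _]addrAC.
move: (f _) (f (x + h *: v)) (f (x + h *: w)) (f x) => c d' e g E1 E2.
by apply: (mulIf hn0); apply: (mulIf hn0); rewrite -E1 -E2; ring.
Qed.

End Calculus.

(** * From partial derivatives to differentials and the chain rule *)

Section PartialDerivatives.
Variable R : realType.

Lemma rV_coord_le_norm n (x : 'rV[R]_n) (i : 'I_n) : `|x 0 i| <= `|x|.
Proof.
rewrite [leRHS]/Num.norm /= mx_normrE.
exact: (le_bigmax _ (fun ij : 'I_1 * 'I_n => `|x ij.1 ij.2|) (ord0, i)).
Qed.

Lemma rV_norm_le n (x : 'rV[R]_n) (e : R) : 0 <= e ->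
  (forall i, `|x 0 i| <= e) -> `|x| <= e.
Proof.
move=> e0 xe; rewrite [leLHS]/Num.norm /= mx_normrE.
by apply: bigmax_le => // -[i j] _ /=; rewrite ord1.
Qed.

Lemma ball_rVP n (x y : 'rV[R]_n) (e : R) : 0 < e ->
  ball x e y <-> forall i, `|x 0 i - y 0 i| < e.
Proof.
move=> e0; split; first by move=> [_ xy] i; exact: xy.
by move=> xy; split => // i j; rewrite ord1; exact: xy.
Qed.

Lemma rV_continuous n (T : topologicalType) (G : T -> 'rV[R]_n) (x : T) :
  (forall j, {for x, continuous (fun x => G x 0 j)}) -> {for x, continuous G}.
Proof.
move=> cG A [P nP sP].
have : \forall y \near x, forall j, P ord0 j (G y 0 j).
  by apply: filter_forall => j; exact: (cG j _ (nP ord0 j)).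
by apply: filterS => y Py; apply: sP => i j; rewrite (ord1 i).
Qed.

Lemma evec_norm n (i : 'I_n) : `|evec R i| <= 1.
Proof.
apply: rV_norm_le => // j; rewrite mxE eqxx /=.
by case: (j == i); rewrite ?normr1 ?normr0.
Qed.

(** The increment is split into moves along one coordinate at a time; each is evaluated by the mean
    value theorem, and continuity of the partials at [y] controls the error. *)
Lemma is_diff_C1 n (f : 'rV[R]_n -> R) (O : set 'rV[R]_n) (y : 'rV[R]_n) :
  open O -> O y -> (forall z i, O z -> derivable f z (evec R i)) ->
  (forall i, {for y, continuous (pderiv i f)}) ->
  is_diff y f (fun h => \sum_i h 0 i * pderiv i f y).
Proof.
move=> oO Oy df cf; pose L := (fun h : 'rV[R]_n => \sum_i h 0 i * pderiv i f y).
have linL : linear L.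
  move=> a u v; rewrite /L scaler_sumr -big_split /=; apply: eq_bigr => i _.
  by rewrite !mxE mulrDl; congr (_ + _); rewrite /GRing.scale/= mulrA.
pose LL := GRing.isLinear.Build _ _ _ _ _ linL.
pose L' : {linear 'rV[R]_n -> R} := HB.pack L LL.
have cL : continuous L'.
  move=> h; rewrite /continuous_at /L' /= /L.
  have FF : Filter (nbhs h) by exact: nbhs_filter.
  apply: cvg_big => [|i _]; first exact: add_continuous.
  by apply: cvgM; [exact: coord_continuous|exact: cvg_cst].
have E : f \o shift y = cst (f y) + L' +o_ (0 : 'rV[R]_n) id.
  apply/eqaddoP => e e0.
  have en0 : 0 < e / n.+1%:R by rewrite divr_gt0.
  have nO : \forall z \near y, O z by exact: open_nbhs_nbhs.
  have nC : \forall z \near y, forall i, `|pderiv i f y - pderiv i f z| <= e / n.+1%:R.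
    have FF : Filter (nbhs y) by exact: nbhs_filter.
    apply: (@filter_forall _ _ (fun i z => `|pderiv i f y - pderiv i f z| <= e / n.+1%:R) _ FF).
    by move=> i; move: (cf i) => /cvgrPdist_le/(_ _ en0).
  have /nbhs_ballP[d /= d0 dO] : nbhs y [set z | O z /\
      forall i, `|pderiv i f y - pderiv i f z| <= e / n.+1%:R] by exact: filterI.
    apply/nbhs_ballP; exists d => //= h; rewrite -ball_normE/= sub0r normrN => hd.
  (* Corners of the coordinate path from [y] to [h + y]: the first [k] coordinates have moved. In
     the sup norm the whole path stays within [|h|] of [y]. *)
  pose p k : 'rV[R]_n := \row_j (y 0 j + h 0 j *+ (j < k)%N).
  have p0 : p 0%N = y by apply/rowP => j; rewrite mxE ltn0 mulr0n addr0.
  have pn : p n = h + y by apply/rowP => j; rewrite !mxE ltn_ord mulr1n addrC.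
  have pS (k : 'I_n) : p k.+1 = p k + h 0 k *: evec R k.
    apply/rowP => j; rewrite !mxE eqxx /= -addrA; congr (_ + _).
    rewrite ltnS leq_eqVlt; have [->|jk] := eqVneq j k.
      by rewrite eqxx ltnn mulr0n add0r mulr1.
    by rewrite val_eqE (negbTE jk) mulr0 addr0.
  have pB (k : 'I_n) t : `|t| <= `|h 0 k| -> ball y d (p k + t *: evec R k).
    move=> th; apply/ball_rVP => // j; rewrite !mxE eqxx /= -addrA opprD addNKr normrN.
    have [->|jk] := eqVneq j k.
      rewrite ltnn mulr0n add0r mulr1 (le_lt_trans th)//.
      exact: le_lt_trans (rV_coord_le_norm _ _) hd.
    rewrite mulr0 addr0; case: (j < k)%N; last by rewrite mulr0n normr0.
    exact: le_lt_trans (rV_coord_le_norm _ _) hd.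
  rewrite [X in `|X|](_ : _ = \sum_(k < n)
      (f (p k.+1) - f (p k) - h 0 k * pderiv k f y)); last first.
    rewrite sumrB -(big_mkord xpredT (fun k => f (p k.+1) - f (p k))).
    by rewrite (telescope_sumr (f \o p)) //= pn p0 -addrA -opprD.
  apply: (le_trans (ler_norm_sum _ _ _)).
  apply: (@le_trans _ _ (\sum_(k < n) e / n.+1%:R * `|h|)); last first.
    rewrite sumr_const card_ord -[leLHS]mulr_natr mulrAC /=.
    apply: ler_wpM2r => //.
    rewrite mulrAC -mulrA ler_piMr ?(ltW e0)// ler_pdivrMr// mul1r ler_nat//.
  apply: ler_sum => k _; rewrite pS.
  have [|t th ->] := @mvt_line _ _ f (p k) (evec R k) (h 0 k).
    by move=> t /pB/dO[+ _]; exact: df.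
  rewrite mulrC -mulrBr normrM mulrC; apply: ler_pM => //.
    by have [_] := dO _ (pB k t th); move/(_ k); rewrite distrC.
  exact: rV_coord_le_norm.
have D := diff_unique cL E.
split; last exact: D.
by apply/diff_locallyP; rewrite D; split.
Qed.

Lemma derive_line (V W : normedModType R) (f : V -> W) (x v : V) :
  'D_1 (fun h : R => f (h *: v + x)) 0 = 'D_v f x.
Proof.
rewrite /derive; set g1 := fun h => h^-1 *: _; set g2 := fun h => h^-1 *: _.
suff -> : g1 = g2 by [].
by rewrite funeqE /g1 /g2 => h /=; rewrite addr0 scale0r add0r [_%:A]mulr1.
Qed.

(** [F] is only known to be derivable along [v], so the differential chain rule is applied to the
    curve [h |-> F (h *: v + x)], for which derivability and differentiability agree. *)
Lemma derive_chain n (u : 'rV[R]_n -> R) (O : set 'rV[R]_n) (V : normedModType R)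
    (F : V -> 'rV[R]_n) (x v : V) :
  open O -> O (F x) -> (forall z i, O z -> derivable u z (evec R i)) ->
  (forall i, {for F x, continuous (pderiv i u)}) ->
  (forall j, derivable (fun x => F x 0 j) x v) ->
  is_derive x v (u \o F)
    (\sum_j pderiv j u (F x) * 'D_v (fun x => F x 0 j) x).
Proof.
move=> oO OFx du cu dF.
have dFx : derivable F x v by apply/derivable_mxP => i j; rewrite ord1.
pose g h := F (h *: v + x).
have g0 : g 0 = F x by rewrite /g scale0r add0r.
have dg : differentiable g 0 by exact: (derivable1_diffP _ _).1 ((derivable1P F x v).1 dFx).
have Dg : 'd g 0 1 = 'D_v F x.
  by rewrite -(deriveE _ dg) derive_line.
have [du' Du] : is_diff (g 0) u (fun h => \sum_i h 0 i * pderiv i u (g 0)).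
  by rewrite g0; exact: is_diff_C1 oO OFx du cu.
have dug : differentiable (u \o g) 0 by exact: differentiable_comp.
split; first exact: (derivable1P (u \o F) x v).2 ((derivable1_diffP _ _).2 dug).
rewrite -derive_line (deriveE _ dug) diff_comp// /= Dg Du derive_mx// g0.
by apply: eq_bigr => j _; rewrite mxE mulrC.
Qed.

End PartialDerivatives.

(** * Smoothness classes *)

Section Smooth.
Variables (R : realType) (n : nat) (O : set 'rV[R]_n).
Hypothesis oO : open O.
Implicit Types (f g : 'rV[R]_n -> R) (x : 'rV[R]_n) (s t : seq 'I_n).

(* The partial derivatives of order k+1 are required to exist as well. *)
Definition smoothk k f := forall s x, (size s <= k)%N -> O x ->
  (forall i, derivable (ipderiv s f) x (evec R i)) /\
  {for x, continuous (ipderiv s f)}.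

Lemma smooth_smoothk f : smooth_on O f <-> forall k, smoothk k f.
Proof.
split=> [sf k s x _|sf s x Ox]; first exact: sf.
exact: (sf (size s)).
Qed.

Lemma smoothkW k l f : (k <= l)%N -> smoothk l f -> smoothk k f.
Proof. by move=> kl sf s x sk; apply: sf; exact: leq_trans sk kl. Qed.

Lemma ipderiv_cat s t f : ipderiv (s ++ t) f = ipderiv s (ipderiv t f).
Proof. by elim: s => //= i s ->. Qed.

Lemma ipderiv_rcons s i f : ipderiv (rcons s i) f = ipderiv s (pderiv i f).
Proof. by rewrite -cats1 ipderiv_cat. Qed.

Lemma near_eq_on f g x : O x -> (forall y, O y -> f y = g y) -> {near x, f =1 g}.
Proof.
by move=> Ox fg; apply: filterS fg _; exact: open_nbhs_nbhs.
Qed.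

Lemma eq_on_pderiv i f g : (forall y, O y -> f y = g y) ->
  forall y, O y -> pderiv i f y = pderiv i g y.
Proof. by move=> fg y Oy; apply: near_eq_derive; exact: near_eq_on. Qed.

Lemma eq_on_ipderiv s f g : (forall y, O y -> f y = g y) ->
  forall y, O y -> ipderiv s f y = ipderiv s g y.
Proof. by move=> fg; elim: s => //= i s IH; exact: eq_on_pderiv. Qed.

Lemma smoothk_eq k f g : (forall y, O y -> f y = g y) -> smoothk k f -> smoothk k g.
Proof.
move=> fg sf s x sk Ox; have [df cf] := sf s x sk Ox.
have E := near_eq_on Ox (eq_on_ipderiv s fg); split.
  by move=> i; exact: near_eq_derivable (df i).
rewrite /prop_for /continuous_at -(eq_on_ipderiv s fg Ox).
exact: cvg_trans (near_eq_cvg E) cf.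
Qed.

(** Splitting off the derivative that acts first lets closure properties be proved by induction on
    [k], with the rules for sums, products and composition used at order one only. *)
Lemma smoothkS k f : smoothk k.+1 f <->
  smoothk 0 f /\ forall i, smoothk k (pderiv i f).
Proof.
split=> [sf|[sf sfi] s x].
  split=> [|i s x sk Ox]; first exact: smoothkW sf.
  by rewrite -ipderiv_rcons; apply: sf => //; rewrite size_rcons.
case/lastP: s => [|s i] sk Ox; first exact: sf.
by rewrite ipderiv_rcons; apply: sfi => //; rewrite size_rcons in sk.
Qed.

Lemma smoothk0 f : (forall x, O x -> (forall i, derivable f x (evec R i)) /\
  {for x, continuous f}) -> smoothk 0 f.
Proof. by move=> sf [|//] x _; exact: sf. Qed.

Lemma smoothk_derivable k f x i : smoothk k f -> O x -> derivable f x (evec R i).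
Proof. by move=> sf Ox; have [] := sf [::] x (leq0n _) Ox. Qed.

Lemma smoothk_continuous k f x : smoothk k f -> O x -> {for x, continuous f}.
Proof. by move=> sf Ox; have [] := sf [::] x (leq0n _) Ox. Qed.

Lemma smoothk_cst k (c : R) : smoothk k (fun=> c).
Proof.
elim: k c => [|k IH] c.
  apply: smoothk0 => x Ox; split; last exact: (@cst_continuous _ _ c x).
  by move=> i; exact: derivable_cst.
apply/smoothkS; split; first exact: smoothkW (IH c).
by move=> i; apply: smoothk_eq (IH 0) => x _; rewrite /pderiv derive_cst.
Qed.

Lemma pderivD i f g x : derivable f x (evec R i) -> derivable g x (evec R i) ->
  pderiv i (fun x => f x + g x) x = pderiv i f x + pderiv i g x.
Proof. by move=> df dg; exact: deriveD. Qed.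

Lemma pderivM i f g x : derivable f x (evec R i) -> derivable g x (evec R i) ->
  pderiv i (fun x => f x * g x) x = pderiv i f x * g x + f x * pderiv i g x.
Proof.
move=> df dg; rewrite addrC [_ * g x]mulrC; exact: (deriveM df dg).
Qed.

Lemma smoothkD k f g : smoothk k f -> smoothk k g -> smoothk k (fun x => f x + g x).
Proof.
elim: k f g => [|k IH] f g sf sg.
  apply: smoothk0 => x Ox; split.
    by move=> i; exact: (derivableD (smoothk_derivable sf Ox) (smoothk_derivable sg Ox)).
  exact: (continuousD (smoothk_continuous sf Ox) (smoothk_continuous sg Ox)).
have [sf' sg'] := (smoothkW (leqnSn k) sf, smoothkW (leqnSn k) sg).
apply/smoothkS; split; first exact: smoothkW (IH _ _ sf' sg').
have [_ sfi] := (smoothkS _ _).1 sf; have [_ sgi] := (smoothkS _ _).1 sg.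
move=> i; apply: smoothk_eq (IH _ _ (sfi i) (sgi i)) => x Ox.
by rewrite pderivD//; [exact: smoothk_derivable sf Ox|exact: smoothk_derivable sg Ox].
Qed.

Lemma smoothkM k f g : smoothk k f -> smoothk k g -> smoothk k (fun x => f x * g x).
Proof.
elim: k f g => [|k IH] f g sf sg.
  apply: smoothk0 => x Ox; split.
    by move=> i; exact: (derivableM (smoothk_derivable sf Ox) (smoothk_derivable sg Ox)).
  exact: (continuousM (smoothk_continuous sf Ox) (smoothk_continuous sg Ox)).
have [sf' sg'] := (smoothkW (leqnSn k) sf, smoothkW (leqnSn k) sg).
apply/smoothkS; split; first exact: smoothkW (IH _ _ sf' sg').
have [_ sfi] := (smoothkS _ _).1 sf; have [_ sgi] := (smoothkS _ _).1 sg.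
move=> i; have S := smoothkD (IH _ _ (sfi i) sg') (IH _ _ sf' (sgi i)).
apply: smoothk_eq S => x Ox.
by rewrite pderivM//; [exact: smoothk_derivable sf Ox|exact: smoothk_derivable sg Ox].
Qed.

Lemma smoothk_sum k (I : Type) (r : seq I) (P : pred I) (f : I -> 'rV[R]_n -> R) :
  (forall i, P i -> smoothk k (f i)) -> smoothk k (fun x => \sum_(i <- r | P i) f i x).
Proof.
move=> sf; elim: r => [|i r IH].
  by apply: smoothk_eq (@smoothk_cst k 0) => x _; rewrite big_nil.
have [Pi|Pi] := boolP (P i); last first.
  by apply: smoothk_eq IH => x _; rewrite big_cons (negbTE Pi).
by apply: smoothk_eq (smoothkD (sf i Pi) IH) => x _; rewrite big_cons Pi.
Qed.

Lemma smoothk_pderiv f i : (forall k, smoothk k f) -> forall k, smoothk k (pderiv i f).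
Proof. by move=> sf k; have [_] := (smoothkS k f).1 (sf k.+1). Qed.

Lemma smoothk_ipderiv f s : (forall k, smoothk k f) -> forall k, smoothk k (ipderiv s f).
Proof. by move=> sf; elim: s => //= i s; exact: smoothk_pderiv. Qed.

Lemma ipderivD s f g x : (forall k, smoothk k f) -> (forall k, smoothk k g) -> O x ->
  ipderiv s (fun x => f x + g x) x = ipderiv s f x + ipderiv s g x.
Proof.
move=> sf sg; elim: s x => //= i s IH x Ox.
rewrite (eq_on_pderiv _ IH)// pderivD//.
  exact: smoothk_derivable (smoothk_ipderiv s sf (k := 0%N)) Ox.
exact: smoothk_derivable (smoothk_ipderiv s sg (k := 0%N)) Ox.
Qed.

Lemma ipderiv_sum s (I : Type) (r : seq I) (P : pred I) (f : I -> 'rV[R]_n -> R) x :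
  (forall i k, P i -> smoothk k (f i)) -> O x ->
  ipderiv s (fun x => \sum_(i <- r | P i) f i x) x = \sum_(i <- r | P i) ipderiv s (f i) x.
Proof.
move=> sf; elim: r x => [|i r IH] x Ox.
  rewrite (eq_on_ipderiv s (g := fun=> 0))// => [|y _]; rewrite !big_nil//.
  elim: s x Ox => //= i s IH x Ox; rewrite (eq_on_pderiv _ IH)//.
  exact: derive_cst.
rewrite big_cons -IH//; have [Pi|Pi] := boolP (P i); last first.
  by apply: eq_on_ipderiv => // y _; rewrite big_cons (negbTE Pi).
rewrite -ipderivD// => [|k|k]; [|exact: sf|by apply: smoothk_sum => j; exact: sf].
by apply: eq_on_ipderiv => // y _; rewrite big_cons Pi.
Qed.

Lemma pderiv_comm f i j x : (forall k, smoothk k f) -> O x ->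
  pderiv i (pderiv j f) x = pderiv j (pderiv i f) x.
Proof.
move=> sf Ox; apply: (schwarz oO Ox).
- move=> y Oy; have D s l := (sf _ s y (leqnn _) Oy).1 l.
  by split; [exact: (D [::])|exact: (D [::])|exact: (D [:: j])|exact: (D [:: i])].
- by have [] := sf _ [:: i; j] x (leqnn _) Ox.
- by have [] := sf _ [:: j; i] x (leqnn _) Ox.
Qed.

(** The classes bound only the derivatives [dalpha], taken in one fixed order of the coordinates;
    this carries those bounds to arbitrary lists. *)
Lemma perm_ipderiv f s t x : (forall k, smoothk k f) -> perm_eq s t -> O x ->
  ipderiv s f x = ipderiv t f x.
Proof.
move=> sf.
have cons_cat i u v y : O y -> ipderiv (u ++ i :: v) f y = ipderiv (i :: u ++ v) f y.
  elim: u y => [y _|j u IH y Oy]; first by [].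
  rewrite [LHS](eq_on_pderiv j IH Oy).
  exact: (pderiv_comm j i (fun k => smoothk_ipderiv (u ++ v) sf (k := k)) Oy).
elim: s t x => [|i s IH] t x st Ox.
  by move: st; rewrite perm_sym => /perm_nilP ->.
have it : i \in t by rewrite -(perm_mem st) mem_head.
case/splitPr: it st => u v st; rewrite cons_cat; last exact: Ox.
apply: (eq_on_pderiv i _ Ox) => y Oy; apply: IH Oy.
by rewrite -(perm_cons i); apply: perm_trans st _; rewrite -cat1s perm_catCA.
Qed.

End Smooth.

(** * Leibniz rule and composition *)

Section Leibniz.
Variables (R : realType).

Lemma leibniz_pascal (a b : nat -> R) k :
  \sum_(q < k.+1) 'C(k, q)%:R * a q.+1 * b (k - q)%N +
  \sum_(q < k.+1) 'C(k, q)%:R * a q * b (k - q).+1 =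
  \sum_(q < k.+2) 'C(k.+1, q)%:R * a q * b (k.+1 - q)%N.
Proof.
rewrite [RHS]big_ord_recl /= bin0 subn0.
under [in RHS]eq_bigr => q _.
  rewrite /bump /= add1n binS natrD addrC !mulrDl subSS; over.
rewrite big_split /= addrCA; congr (_ + _).
rewrite big_ord_recl /= bin0 subn0; congr (_ + _).
rewrite [RHS]big_ord_recr /= bin_small// !mul0r addr0.
apply: eq_bigr => q _; rewrite /bump /= add1n.
by rewrite subnSK.
Qed.

(** Since the majorants depend only on the number of derivatives, the sum over sublists collapses to
    the one-variable binomial sum. In the induction the derivative acting first shifts either [a] or
    [b], and Pascal's rule recombines the two sums. *)
Lemma leibniz_bound n (O : set 'rV[R]_n) (s : seq 'I_n) (f g : 'rV[R]_n -> R)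
    (a b : nat -> R) (x : 'rV[R]_n) : open O -> O x ->
  (forall k, smoothk O k f) -> (forall k, smoothk O k g) ->
  (forall t, (size t <= size s)%N -> `|ipderiv t f x| <= a (size t)) ->
  (forall t, (size t <= size s)%N -> `|ipderiv t g x| <= b (size t)) ->
  `|ipderiv s (fun x => f x * g x) x| <=
    \sum_(q < (size s).+1) 'C(size s, q)%:R * a q * b (size s - q)%N.
Proof.
move=> oO Ox; elim/last_ind: s f g a b => [|s i IH] f g a b sf sg fa gb.
  rewrite big_ord_recl big_ord0 addr0 /= bin0 mul1r normrM.
  by apply: ler_pM => //; [exact: (fa [::])|exact: (gb [::])].
have sfi := smoothk_pderiv i sf; have sgi := smoothk_pderiv i sg.
rewrite ipderiv_rcons (eq_on_ipderiv oO s (g := fun x =>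
  pderiv i f x * g x + f x * pderiv i g x))//; last first.
  move=> y Oy; apply: pderivM.
    exact: smoothk_derivable (sf 0%N) Oy.
  exact: smoothk_derivable (sg 0%N) Oy.
rewrite (ipderivD oO)//; [|by move=> k; exact: smoothkM..].
rewrite size_rcons -leibniz_pascal (le_trans (ler_normD _ _))// lerD//.
  apply: (IH _ _ (fun q => a q.+1) b) => // t ts.
    by rewrite -ipderiv_rcons -(size_rcons t i); apply: fa; rewrite !size_rcons ltnS.
  by apply: gb; rewrite size_rcons leqW.
apply: (IH _ _ a (fun q => b q.+1)) => // t ts.
  by apply: fa; rewrite size_rcons leqW.
by rewrite -ipderiv_rcons -(size_rcons t i); apply: gb; rewrite !size_rcons ltnS.
Qed.

Lemma convolution_term_bound (N : nat -> R) (e : R) : 0 <= e -> (forall m, 0 <= N m) ->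
  (forall m, m.+1%:R * N m <= e * N m.+1) ->
  forall p q r, 'C(q + r, q)%:R * (r.+1)`!%:R * N (p + q)%N
    <= (2 * e) ^+ r * N (p + q + r)%N.
Proof.
move=> e0 N0 NS p q r.
have grow : ('C(q + r, q) * r`!)%:R * N (p + q)%N <= e ^+ r * N (p + q + r)%N.
  elim: r => [|r IH]; first by rewrite !addn0 binn expr0 !mul1r.
  (* The new factor [(q + r).+1] is at most [(p + q + r).+1], so the growth of [N] absorbs it for
     one more [e]. *)
  have -> : ('C(q + r.+1, q) * r.+1`! = (q + r).+1 * ('C(q + r, q) * r`!))%N.
    apply/eqP; rewrite -(eqn_pmul2r (fact_gt0 q)); apply/eqP.
    have H k : ('C(q + k, q) * k`! * q`! = (q + k)`!)%N.
      by rewrite -(bin_fact (leq_addr k q)) addKn; lia.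
    by rewrite H -mulnA H addnS factS.
  rewrite natrM -mulrA; apply: (le_trans (ler_wpM2l (ler0n _ _) IH)).
  rewrite mulrCA exprSr -mulrA ler_wpM2l ?exprn_ge0//.
  by rewrite addnS; apply: le_trans (NS _); rewrite ler_wpM2r// ler_nat; lia.
rewrite factS natrM exprMn.
have r2 : r.+1%:R <= 2 ^+ r :> R by rewrite -natrX ler_nat ltn_expl.
have grow0 : 0 <= ('C(q + r, q) * r`!)%:R * N (p + q)%N by rewrite mulr_ge0.
have := ler_pM (ler0n _ _) grow0 r2 grow; rewrite natrM.
move: (2 ^+ r) (e ^+ r) (N _) (N _) => a b c d; lra.
Qed.

End Leibniz.

(** * Smoothness and derivative bounds of a composition *)

Section Composition.
Variables (R : realType) (n1 n2 : nat).
Variables (O1 : set 'rV[R]_n1) (O2 : set 'rV[R]_n2) (F : 'rV[R]_n1 -> 'rV[R]_n2).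
Hypotheses (oO1 : open O1) (oO2 : open O2) (FO : forall x, O1 x -> O2 (F x)).
Hypothesis sF : forall j k, smoothk O1 k (fun x => F x 0 j).

Lemma is_derive_comp (u : 'rV[R]_n2 -> R) x i : smoothk O2 1 u -> O1 x ->
  is_derive x (evec R i) (u \o F)
   (\sum_j pderiv j u (F x) * pderiv i (fun x => F x 0 j) x).
Proof.
move=> su Ox; have [_ sui] := (smoothkS _ _ _).1 su.
apply: (derive_chain oO2 (FO Ox)).
- by move=> z l Oz; exact: smoothk_derivable su Oz.
- by move=> l; apply: smoothk_continuous (sui l) (FO Ox).
- by move=> j; exact: smoothk_derivable (sF j (k := 0%N)) Ox.
Qed.

Lemma smoothk_comp (u : 'rV[R]_n2 -> R) : (forall k, smoothk O2 k u) ->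
  forall k, smoothk O1 k (u \o F).
Proof.
move=> + k; elim: k u => [|k IH] u su.
  apply: smoothk0 => x Ox; split; first by move=> i; have [] := is_derive_comp i (su 1%N) Ox.
  apply: continuous_comp; last exact: smoothk_continuous (su 0%N) (FO Ox).
  by apply: rV_continuous => j; exact: smoothk_continuous (sF j (k := 0%N)) Ox.
apply/smoothkS; split; first exact: smoothkW (IH u su).
move=> i; apply: (smoothk_eq oO1 (f := fun x =>
    \sum_j (pderiv j u \o F) x * pderiv i (fun x => F x 0 j) x)).
  by move=> x Ox; have [_ <-] := is_derive_comp i (su 1%N) Ox.
apply: smoothk_sum => // j _; apply: smoothkM => //.
  by apply: IH; exact: smoothk_pderiv.
by apply: smoothk_pderiv => l; exact: sF.
Qed.

(** Right side of the Leibniz estimate for one chain rule step: [q] derivatives fall on a first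
    partial of the outer function composed with [F], the other [k - q] on a first partial of [F_l],
    which accounts for the exponent [(k - q).+1]. *)
Lemma comp_step_bound (N : nat -> R) (e C0 K A L rho : R) j k :
  0 <= e -> (forall m, 0 <= N m) -> (forall m, m.+1%:R * N m <= e * N m.+1) ->
  0 <= C0 -> 0 <= K -> 0 <= A -> 0 <= rho ->
  4 * e * A <= L -> 2 * n2%:R * K * A * rho <= L ->
  \sum_(l < n2) \sum_(q < k.+1) 'C(k, q)%:R *
     (C0 * L ^+ q * rho ^+ j.+1 * N (j.+1 + q)%N) *
     (K * A ^+ (k - q).+1 * (k - q).+1`!%:R)
  <= C0 * L ^+ k.+1 * rho ^+ j * N (j + k.+1)%N.
Proof.
move=> e0 N0 NS C00 K0 A0 rho0 hL1 hL2.
have L0 : 0 <= L by apply: le_trans hL1; rewrite !mulr_ge0.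
pose T := C0 * rho ^+ j.+1 * K * A * N (j + k.+1)%N.
have T0 : 0 <= T by rewrite !mulr_ge0// exprn_ge0.
have term (q : 'I_k.+1) : 'C(k, q)%:R *
     (C0 * L ^+ q * rho ^+ j.+1 * N (j.+1 + q)%N) *
     (K * A ^+ (k - q).+1 * (k - q).+1`!%:R) <= T * (L ^+ k * 2^-1 ^+ (k - q)).
  have qk : (q <= k)%N by rewrite -ltnS.
  have H := convolution_term_bound e0 N0 NS j.+1 q (k - q).
  rewrite -addnA subnKC// [(j.+1 + k)%N]addSnnS in H.
  have -> : 'C(k, q)%:R * (C0 * L ^+ q * rho ^+ j.+1 * N (j.+1 + q)%N) *
     (K * A ^+ (k - q).+1 * (k - q).+1`!%:R) =
     (C0 * rho ^+ j.+1 * K * A * (L ^+ q * A ^+ (k - q))) *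
     ('C(k, q)%:R * (k - q).+1`!%:R * N (j.+1 + q)%N).
    by rewrite [A ^+ (k - q).+1]exprS; ring.
  have P0 : 0 <= C0 * rho ^+ j.+1 * K * A * (L ^+ q * A ^+ (k - q)).
    by rewrite !mulr_ge0// exprn_ge0.
  apply: le_trans (ler_wpM2l P0 H) _.
  rewrite /T.
  set z := (k - q)%N.
  have -> : L ^+ k = L ^+ q * L ^+ z by rewrite -exprD subnKC.
  (* Here [4 * e * A <= L] is spent: it says that [2 e A <= L / 2]. *)
  have H2 : A ^+ z * (2 * e) ^+ z <= L ^+ z * 2^-1 ^+ z.
    rewrite -!exprMn lerXn2r ?nnegrE ?mulr_ge0//.
    by rewrite ler_pdivlMr//; apply: le_trans hL1; lra.
  have Q0 : 0 <= C0 * rho ^+ j.+1 * K * A * N (j + k.+1)%N * L ^+ q.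
    by rewrite !mulr_ge0// exprn_ge0.
  have := ler_wpM2l Q0 H2.
  move: (A ^+ z) ((2 * e) ^+ z) (L ^+ z) (2^-1 ^+ z) (L ^+ q) (rho ^+ _) (N _).
  by move=> *; lra.
apply: (@le_trans _ _ (\sum_(l < n2) T * (L ^+ k * 2))).
  apply: ler_sum => l _; apply: (le_trans (ler_sum _ (fun q _ => term q))).
  rewrite -mulr_sumr ler_wpM2l// -mulr_sumr ler_wpM2l ?exprn_ge0//.
  (* Reversing the order of summation turns the exponent [k - q] into the index of a geometric sum,
     bounded by its limit 2. *)
  rewrite (reindex_inj rev_ord_inj) /=.
  rewrite (eq_bigr (fun q : 'I_k.+1 => geometric 1 2^-1 q)); last first.
    by move=> q _; rewrite /= mul1r subSS subKn// -ltnS.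
  rewrite -(big_mkord xpredT (geometric 1 2^-1)).
  have := @geometric_le_lim R k.+1 1 2^-1 ler01; rewrite /series /= => H.
  apply: le_trans (H _ _) _; rewrite ?invr_gt0// ?ger0_norm ?invr_ge0//.
    by rewrite invf_lt1// ltr1n.
  by rewrite le_eqVlt; apply/orP; left; apply/eqP; field.
rewrite sumr_const card_ord -mulr_natl /T.
have Q0 : 0 <= C0 * rho ^+ j * N (j + k.+1)%N * L ^+ k.
  by rewrite !mulr_ge0// exprn_ge0.
have := ler_wpM2l Q0 hL2.
rewrite [rho ^+ j.+1]exprSr [L ^+ k.+1]exprSr.
move: (rho ^+ j) (L ^+ k) (N _) => x y z; lra.
Qed.

(* The weight is indexed by |t| + |s|: one step of the chain rule trades a
   derivative of u o F for one more derivative of u. *)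
Lemma comp_bound (u : 'rV[R]_n2 -> R) (N : nat -> R) (e C0 K A L rho : R) x :
  0 <= e -> (forall m, 0 <= N m) -> (forall m, m.+1%:R * N m <= e * N m.+1) ->
  0 <= C0 -> 0 <= K -> 0 <= A -> 0 <= rho ->
  4 * e * A <= L -> 2 * n2%:R * K * A * rho <= L ->
  (forall k, smoothk O2 k u) -> O1 x ->
  (forall t, `|ipderiv t u (F x)| <= C0 * rho ^+ size t * N (size t)) ->
  (forall s j, `|ipderiv s (fun x => F x 0 j) x| <= K * A ^+ size s * (size s)`!%:R) ->
  forall s t, `|ipderiv s (ipderiv t u \o F) x| <=
    C0 * L ^+ size s * rho ^+ size t * N (size t + size s)%N.
Proof.
move=> e0 N0 NS C00 K0 A0 rho0 hL1 hL2 su Ox ub Fb s.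
(* Strong induction with [t] still general: Leibniz calls the bound for every shorter list of
   derivatives, with [t] lengthened by the direction [j] of the chain rule. *)
have [k] := ubnP (size s); elim: k s => // k IH s sk t.
case/lastP: s sk => [|s i]; first by rewrite /= addn0 expr0 mulr1.
rewrite size_rcons ltnS => sk.
have sut s' := smoothk_ipderiv s' su.
rewrite ipderiv_rcons (eq_on_ipderiv oO1 s (g := fun x =>
    \sum_j (ipderiv (j :: t) u \o F) x * pderiv i (fun x => F x 0 j) x))//; last first.
  by move=> y Oy; have [_ <-] := is_derive_comp i (sut t 1%N) Oy.
have sFi j k' : smoothk O1 k' (pderiv i (fun x => F x 0 j)).
  by apply: smoothk_pderiv => l; exact: sF.
rewrite (ipderiv_sum oO1)//; last first.
  move=> j k' _; apply: smoothkM => //; apply: smoothk_comp.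
  by move=> l; exact: sut.
apply: le_trans (comp_step_bound (size t) (size s) e0 N0 NS C00 K0 A0 rho0 hL1 hL2).
apply: (le_trans (ler_norm_sum _ _ _)); apply: ler_sum => j _.
apply: (leibniz_bound
  (a := fun q => C0 * L ^+ q * rho ^+ (size t).+1 * N ((size t).+1 + q)%N)
  (b := fun q => K * A ^+ q.+1 * q.+1`!%:R) oO1 Ox).
- by apply: smoothk_comp => l; exact: sut.
- exact: sFi.
- by move=> s' ss'; apply: (IH s' (leq_ltn_trans ss' sk) (j :: t)).
- by move=> s' _; rewrite -ipderiv_rcons -(size_rcons s' i).
Qed.

End Composition.

(** * Weight sequences *)

Section Weights.
Variable R : realType.
Implicit Type M : nat -> R.

Lemma weight_sequence_ge1 M k : weight_sequence M -> 1 <= M k /\ 1 <= M k.+1 / M k.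
Proof.
move=> [M0 M1 Mc _]; elim: k => [|k [IH1 IH2]]; first by split; [rewrite M0|exact: M1].
split; last exact: le_trans (Mc k).
have Mk : 0 < M k by exact: lt_le_trans ltr01 IH1.
by apply: (le_trans IH1); move: IH2; rewrite ler_pdivlMr// mul1r.
Qed.

(** As M_0 = 1, the left side is the product of the first [k.+1] ratios, the last of which is the
    largest. *)
Lemma weight_sequence_le_ratio M k : weight_sequence M ->
  M k.+1 <= (M k.+1 / M k) ^+ k.+1.
Proof.
move=> wM; have [M0 _ Mc _] := wM; elim: k => [|k IH].
  by rewrite expr1 M0 divr1.
have [Mk1 rk] := weight_sequence_ge1 k wM; have [Mk2 rk2] := weight_sequence_ge1 k.+1 wM.
have Mk0 : 0 < M k.+1 by exact: lt_le_trans ltr01 Mk2.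
rewrite exprS -[leLHS](@divfK _ (M k.+1)) ?gt_eqF//.
apply: ler_wpM2l; first by rewrite (le_trans _ rk2).
apply: (le_trans IH); rewrite lerXn2r ?nnegrE//.
  by rewrite (le_trans _ rk).
by rewrite (le_trans _ rk2).
Qed.

(** A weak Stirling bound; the induction step is (1 + 1/k)^k <= e. *)
Lemma exprn_le_fact_expR k : k%:R ^+ k <= k`!%:R * expR 1 ^+ k :> R.
Proof.
elim: k => [|k IH]; first by rewrite !expr0 mulr1.
have -> : (k.+1`!%:R * expR 1 ^+ k.+1 : R) = k.+1%:R * (expR 1 * (k`!%:R * expR 1 ^+ k)).
  by rewrite factS natrM exprS; ring.
rewrite exprS ler_wpM2l//; case: k IH => [_|k IH].
  by rewrite !expr0 !mulr1 -expR0 ler_expR.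
apply: le_trans (ler_wpM2l (expR_ge0 1) IH).
have k0 : k.+1%:R != 0 :> R by rewrite pnatr_eq0.
rewrite -[X in expR X](mulfV k0) expRM_natl -exprMn lerXn2r ?nnegrE ?mulr_ge0 ?expR_ge0//.
apply: le_trans (ler_wpM2r (ler0n _ _) (expR_ge1Dx _)).
by rewrite mulrDl mul1r mulVf// -[k.+2%:R]natr1.
Qed.

Lemma eventually_ratio_ge M (T : R) : weight_sequence M ->
  (fun k : nat => small_m M k `^ (k%:R)^-1) @ \oo --> +oo ->
  exists K, forall k, (K <= k)%N -> T * k.+1%:R <= M k.+1 / M k.
Proof.
(* The factor e makes up for the loss in k^k <= k! e^k; the maximum with 0 makes the bases
   nonnegative, so that (k+1)-st powers can be compared. *)
move=> wM /cvgryPge/(_ (Num.max 0 T * expR 1)) [K _ hK].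
exists K => k Kk; have := hK k.+1 (leqW Kk); rewrite /= => le.
have [Mk1 rk] := weight_sequence_ge1 k wM; have [Mk2 _] := weight_sequence_ge1 k.+1 wM.
have k0 : (0 : R) < k.+1%:R by [].
set T' := Num.max 0 T in le; have T0 : 0 <= T' by rewrite le_max lexx.
have m0 : 0 <= small_m M k.+1 by rewrite divr_ge0// (le_trans _ Mk2).
have : (T' * expR 1) ^+ k.+1 <= small_m M k.+1.
  rewrite -[leRHS]powRr1// -[X in _ `^ X](@mulVf _ k.+1%:R) ?gt_eqF// powRrM powR_mulrn ?powR_ge0//.
  by apply: lerXn2r; rewrite ?nnegrE ?powR_ge0 ?mulr_ge0 ?expR_ge0.
rewrite ler_pdivlMr ?ltr0n ?fact_gt0// => H.
apply: (@le_trans _ _ (T' * k.+1%:R)); first by rewrite ler_wpM2r// le_max lexx orbT.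
rewrite -(@ler_pXn2r _ k.+1) ?nnegrE ?(le_trans ler01 rk) ?mulr_ge0//.
apply: le_trans (weight_sequence_le_ratio k wM); apply: le_trans H.
rewrite !exprMn -mulrA ler_wpM2l ?exprn_ge0// mulrC.
exact: exprn_le_fact_expR.
Qed.

(* The least sequence above M with (k+1) N_k <= e N_(k+1). *)
Fixpoint regularized M (e : R) (k : nat) : R :=
  if k is k'.+1 then Num.max (M k) (k%:R / e * regularized M e k') else M 0%N.

Lemma regularized_ge M e k : M k <= regularized M e k.
Proof. by case: k => [|k] //=; rewrite le_max lexx. Qed.

Lemma regularized_growth M e k : 0 < e ->
  k.+1%:R * regularized M e k <= e * regularized M e k.+1.
Proof.
move=> e0; rewrite -ler_pdivrMl//= le_max; apply/orP; right.
by rewrite mulrA [e^-1 * _]mulrC.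
Qed.

(** Once mu_(k+1) >= (k+1) / e, a bound by [C * M k] passes to the next index with the same [C]; the
    finitely many earlier indices are absorbed in [C]. *)
Lemma regularized_le M e : 0 < e -> weight_sequence M ->
  (fun k : nat => small_m M k `^ (k%:R)^-1) @ \oo --> +oo ->
  exists2 C, 0 < C & forall k, regularized M e k <= C * M k.
Proof.
move=> e0 wM mM; have [K hK] := eventually_ratio_ge e^-1 wM mM.
have Mp k : 0 < M k.
  by have [Mk _] := weight_sequence_ge1 k wM; exact: lt_le_trans ltr01 Mk.
have [C C1 hC] : exists2 C, 1 <= C & forall k, (k <= K)%N -> regularized M e k <= C * M k.
  elim: (K) => [|k [C C1 hC]].
    by exists 1 => // k; rewrite leqn0 => /eqP -> /=; rewrite mul1r.
  exists (C + `|regularized M e k.+1| / M k.+1).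
    by rewrite (le_trans C1)// lerDl divr_ge0// ltW.
  move=> j; rewrite leq_eqVlt ltnS => /predU1P[->|jk].
    rewrite mulrDl divfK ?gt_eqF//; apply: (le_trans (ler_norm _)); rewrite lerDr.
    by rewrite mulr_ge0 ?(ltW (Mp _))// (le_trans _ C1).
  by apply: (le_trans (hC j jk)); rewrite ler_wpM2r ?(ltW (Mp _))// lerDl divr_ge0// ltW.
exists C; first exact: lt_le_trans ltr01 C1.
elim=> [|k IH]; first exact: hC.
have [kK|Kk] := ltnP k K; first exact: hC.
have C0 : 0 <= C by rewrite (le_trans _ C1).
rewrite [regularized _ _ _]/= ge_max; apply/andP; split.
  by rewrite ler_peMl// ltW.
have k0 : 0 <= k.+1%:R / e by rewrite divr_ge0// ltW.
apply: (le_trans (ler_wpM2l k0 IH)); rewrite mulrCA ler_wpM2l//.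
by move: (hK k Kk); rewrite ler_pdivlMr// [e^-1 * _]mulrC.
Qed.

End Weights.

(** * Real analytic functions *)

Lemma cvgn_le (R : realType) (u : nat -> R) (l c : R) :
  u N @[N --> \oo] --> l -> (forall N, u N <= c) -> l <= c.
Proof.
move=> ul uc; rewrite -(cvg_lim _ ul)//; apply: limr_le; last exact: nearW.
by apply/cvg_ex; exists l.
Qed.

(** * Pointwise limits of functions with uniformly bounded derivatives *)

Section PointwiseLimit.
Variables (R : realType) (n : nat) (O : set 'rV[R]_n).
Hypothesis oO : open O.

Lemma taylor2_line (f : 'rV[R]_n -> R) (x : 'rV[R]_n) (b h : R) i :
  (forall t, `|t| <= `|h| -> [/\ derivable f (x + t *: evec R i) (evec R i),
     derivable (pderiv i f) (x + t *: evec R i) (evec R i) &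
     `|pderiv i (pderiv i f) (x + t *: evec R i)| <= b]) ->
  `|f (x + h *: evec R i) - f x - h * pderiv i f x| <= b * h ^+ 2.
Proof.
move=> H.
have [|t th ->] := @mvt_line _ _ f x (evec R i) h; first by move=> t /H[].
have [|t' th' E] := @mvt_line _ _ (pderiv i f) x (evec R i) t.
  by move=> t' t't; have [] := H t' (le_trans t't th).
have [_ _ B] := H t' (le_trans th' th).
rewrite -/(pderiv i f _) mulrC -mulrBr E -/(pderiv i (pderiv i f) _) !normrM.
move: (pderiv i (pderiv i f) _) B => z B.
rewrite mulrC -mulrA -real_normK ?num_real// expr2.
by apply: ler_pM; rewrite ?mulr_ge0 ?normr_ge0 ?ler_wpM2r.
Qed.

(** Bounds independent of [N] on all derivatives replace uniform convergence. The limits of the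
    derivatives are left unnamed, and [b] is indexed by lists, so that differentiating once gives
    data of the same shape. *)
Definition bounded_cvg (S : nat -> 'rV[R]_n -> R) (f : 'rV[R]_n -> R) b :=
  [/\ forall N k, smoothk O k (S N),
      forall N s x, O x -> `|ipderiv s (S N) x| <= b s,
      forall s x, O x -> cvgn (fun N => ipderiv s (S N) x) &
      forall x, O x -> S N x @[N --> \oo] --> f x].

Variables (S : nat -> 'rV[R]_n -> R) (f : 'rV[R]_n -> R) (b : seq 'I_n -> R).
Hypothesis Sf : bounded_cvg S f b.

(* The uniform bound on the second derivatives makes the Taylor remainder of
   order two pass to the pointwise limit. *)
Lemma limit_derivable x i : O x ->
  is_derive x (evec R i) f (limn (fun N => pderiv i (S N) x)).
Proof.
move=> Ox; have [sS bS cS cf] := Sf.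
have /nbhs_ballP[r /= r0 rO] : nbhs x O by exact: open_nbhs_nbhs.
have line t : `|t| < r -> O (x + t *: evec R i).
  move=> tr; apply: rO; rewrite -ball_normE /= opprD addNKr normrN normrZ.
  by rewrite (le_lt_trans _ tr)// ler_piMr// evec_norm.
have T h : `|h| < r ->
    `|f (x + h *: evec R i) - f x - h * limn (fun N => pderiv i (S N) x)|
    <= b [:: i; i] * h ^+ 2.
  move=> hr.
  have C : `|S N (x + h *: evec R i) - S N x - h * pderiv i (S N) x| @[N --> \oo]
     --> `|f (x + h *: evec R i) - f x - h * limn (fun N => pderiv i (S N) x)|.
    apply: cvg_norm; apply: cvgB; first by apply: cvgB; apply: cf => //; exact: line.
    by apply: cvgMr; exact: (cS [:: i]).
  apply: (cvgn_le C) => N; apply: taylor2_line => t th.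
  have Ot : O (x + t *: evec R i) by apply: line; exact: le_lt_trans hr.
  have D s l := (sS N _ s _ (leqnn _) Ot).1 l.
  split; [exact: (D [::])|exact: (D [:: i])|exact: (bS N [:: i; i])].
set l := limn _ in T *.
suff C : h^-1 *: ((f \o shift x) (h *: evec R i) - f x) @[h --> 0^'] --> l.
  by split; [apply/cvg_ex; exists l|exact: cvg_lim C].
pose B := `|b [:: i; i]| + 1.
have B0 : 0 < B by rewrite ltr_wpDl.
apply/cvgrPdist_le => e e0; near=> h.
have h0 : h != 0 by near: h; exact: nbhs_dnbhs_neq.
have hr : `|h| < r by near: h; exact: dnbhs0_lt.
have he : `|h| < e / B by near: h; apply: dnbhs0_lt; rewrite divr_gt0.
rewrite /= distrC [h *: _ + x]addrC.
have -> : h^-1 *: (f (x + h *: evec R i) - f x) - l =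
    h^-1 * (f (x + h *: evec R i) - f x - h * l).
  by rewrite [RHS]mulrBr mulKf.
rewrite normrM normfV ler_pdivrMl ?normr_gt0//.
apply: (le_trans (T h hr)); rewrite -real_normK ?num_real// expr2 mulrCA ler_wpM2l//.
rewrite mulrC; apply: (@le_trans _ _ (`|h| * B)).
  by rewrite ler_wpM2l// (le_trans (ler_norm _))// lerDl.
by rewrite -ler_pdivlMr// ltW.
Unshelve. all: by end_near. Qed.

(** The mean value theorem on segments and the first-order bounds give the [S N] a common Lipschitz
    constant on a ball, which survives in the limit. *)
Lemma limit_continuous x : O x -> {for x, continuous f}.
Proof.
move=> Ox; have [sS bS cS cf] := Sf.
have /nbhs_ballP[r /= r0 rO] : nbhs x O by exact: open_nbhs_nbhs.
pose B := \sum_i `|b [:: i]| + 1.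
have B0 : 0 < B by rewrite ltr_wpDl// sumr_ge0.
have L y : ball x r y -> `|f x - f y| <= B * `|x - y|.
  move=> xy; have Oy := rO _ xy.
  have C : `|S N x - S N y| @[N --> \oo] --> `|f x - f y|.
    by apply: cvg_norm; apply: cvgB; exact: cf.
  apply: (cvgn_le C) => N.
  have Ot t : `|t| <= `|1 : R| -> O (x + t *: (y - x)).
    rewrite normr1 => t1; apply: rO; move: xy; rewrite -!ball_normE /=.
    rewrite opprD addNKr normrN normrZ distrC; apply: le_lt_trans.
    by rewrite distrC ler_piMl.
  have [_ sSi] := (smoothkS _ _ _).1 (sS N 1%N).
  have D t : `|t| <= `|1 : R| -> is_diff (x + t *: (y - x)) (S N)
      (fun h => \sum_i h 0 i * pderiv i (S N) (x + t *: (y - x))).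
    move=> /Ot Ot1; apply: (is_diff_C1 oO Ot1).
      by move=> z i Oz; exact: smoothk_derivable (sS N 0%N) Oz.
    by move=> i; exact: smoothk_continuous (sSi i) Ot1.
  have [|t t1] := @mvt_line _ _ (S N) x (y - x) 1.
    by move=> t /D[dS _]; exact: diff_derivable.
  have [dS DS] := D t t1.
  rewrite scale1r (addrC x) subrK (deriveE _ dS) DS mulr1 => E.
  rewrite distrC E (le_trans (ler_norm_sum _ _ _))//.
  apply: (@le_trans _ _ (\sum_i `|b [:: i]| * `|x - y|)).
    apply: ler_sum => i _; rewrite normrM mulrC; apply: ler_pM => //.
      apply: le_trans (ler_norm _); exact: (bS N [:: i] _ (Ot t t1)).
    by rewrite distrC; exact: rV_coord_le_norm.
  by rewrite -mulr_suml ler_wpM2r// lerDl.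
have FF : Filter (nbhs x) by exact: nbhs_filter.
apply/cvgrPdist_le => e e0.
have eB : 0 < e / B by rewrite divr_gt0.
suff : nbhs x [set y | `|f x - f y| <= e] by [].
apply/nbhs_ballP; exists (Num.min r (e / B)); first by rewrite /= lt_min r0.
move=> y xy; apply: (@le_trans _ _ (B * `|x - y|)).
  by apply: L; apply: le_ball xy; rewrite ge_min lexx.
move: xy; rewrite -ball_normE /= lt_min => /andP[_ /ltW].
by rewrite ler_pdivlMr// mulrC.
Qed.

End PointwiseLimit.

Section PointwiseLimitSmooth.
Variables (R : realType) (n : nat) (O : set 'rV[R]_n).
Hypothesis oO : open O.

Lemma bounded_cvg_pderiv (S : nat -> 'rV[R]_n -> R) f b i : bounded_cvg O S f b ->
  bounded_cvg O (fun N => pderiv i (S N)) (pderiv i f) (fun s => b (rcons s i)).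
Proof.
move=> Sf; have [sS bS cS cf] := Sf; split.
- by move=> N k; apply: smoothk_pderiv => l; exact: sS.
- by move=> N s x Ox; rewrite -ipderiv_rcons; exact: bS.
- move=> s x Ox; have := cS (rcons s i) x Ox.
  by under eq_fun do rewrite ipderiv_rcons.
- move=> x Ox; have [_ D] := limit_derivable oO Sf i Ox.
  by rewrite /pderiv D; exact: (cS [:: i]).
Qed.

Lemma bounded_cvg_smooth (S : nat -> 'rV[R]_n -> R) f b : bounded_cvg O S f b ->
  (forall k, smoothk O k f) /\ forall s x, O x -> `|ipderiv s f x| <= b s.
Proof.
move=> Sf; split.
  move=> k; elim: k S f b Sf => [|k IH] S f b Sf.
    apply: smoothk0 => x Ox; split; last exact: (limit_continuous oO Sf).
    by move=> i; have [] := limit_derivable oO Sf i Ox.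
  apply/smoothkS; split; first exact: smoothkW (IH _ _ _ Sf).
  by move=> i; exact: IH (bounded_cvg_pderiv i Sf).
move=> s; elim/last_ind: s S f b Sf => [|s i IH] S f b Sf x Ox.
  have [sS bS _ cf] := Sf.
  by apply: (cvgn_le (cvg_norm (cf x Ox))) => N; exact: (bS N [::]).
by rewrite ipderiv_rcons; exact: IH (bounded_cvg_pderiv i Sf) x Ox.
Qed.

End PointwiseLimitSmooth.

(** * Cauchy-type bounds for polynomials *)

Section GeomBounded.
Variables (R : realType) (n : nat) (O : set 'rV[R]_n).
Hypothesis oO : open O.

Definition geom_bounded (A B : R) (f : 'rV[R]_n -> R) :=
  (forall k, smoothk O k f) /\
  forall s x, O x -> `|ipderiv s f x| <= B * A ^+ size s * (size s)`!%:R.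

Lemma geom_bounded_eq A B f g : (forall x, O x -> f x = g x) ->
  geom_bounded A B f -> geom_bounded A B g.
Proof.
move=> fg [sf bf]; split; first by move=> k; exact (smoothk_eq oO fg (sf k)).
by move=> s x Ox; rewrite -(eq_on_ipderiv oO s fg Ox); exact: bf.
Qed.

Lemma ipderiv_cst s (c : R) x : O x ->
  ipderiv s (fun=> c) x = if s is [::] then c else 0.
Proof.
elim: s x => // i s IH x Ox /=.
rewrite (eq_on_pderiv oO i IH Ox); case: {IH} s => [|j s]; exact: derive_cst.
Qed.

Lemma geom_bounded_cst A (c : R) : 0 <= A -> geom_bounded A `|c| (fun=> c).
Proof.
move=> A0; split; first by move=> k; exact: smoothk_cst.
move=> [|i s] x Ox; rewrite ipderiv_cst//.
  by rewrite expr0 !mulr1.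
by rewrite normr0 !mulr_ge0// exprn_ge0.
Qed.

Lemma is_derive_coord (i j : 'I_n) (c : R) (x : 'rV[R]_n) :
  is_derive x (evec R i) (fun x => x 0 j - c) (i == j)%:R.
Proof.
have D : is_derive x (evec R i) (fun x : 'rV[R]_n => x 0 j) (i == j)%:R.
  have := derive_mx (@derivable_id _ _ x (evec R i)).
  rewrite derive_id => /matrixP/(_ 0 j); rewrite !mxE eqxx /= => E.
  split; last by rewrite -E eq_sym.
  exact: (derivable_mxP _ _ _).1 (@derivable_id _ _ x (evec R i)) 0 j.
have := is_deriveB D (is_derive_cst c x (evec R i)).
by rewrite subr0.
Qed.

Lemma pderiv_coord (i j : 'I_n) (c : R) (x : 'rV[R]_n) :
  pderiv i (fun x => x 0 j - c) x = (i == j)%:R.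
Proof. by have [_] := is_derive_coord i j c x. Qed.

Lemma smoothk_coord (j : 'I_n) (c : R) k : smoothk O k (fun x => x 0 j - c).
Proof.
have S0 : smoothk O 0 (fun x => x 0 j - c).
  apply: smoothk0 => x Ox; split; first by move=> i; have [] := is_derive_coord i j c x.
  exact: (continuousB (@coord_continuous _ _ _ 0 j x) (@cst_continuous _ _ c x)).
case: k => [//|k]; apply/smoothkS; split => // i.
by apply: (smoothk_eq oO _ (smoothk_cst oO (k := k) (i == j)%:R)) => x _; rewrite pderiv_coord.
Qed.

Lemma ipderiv_coord_bound s (j : 'I_n) (c d : R) x : O x -> `|x 0 j - c| <= d ->
  `|ipderiv s (fun x => x 0 j - c) x| <= nth 0 [:: d; 1] (size s).
Proof.
move=> Ox xd; case/lastP: s => [//|s i].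
rewrite ipderiv_rcons (eq_on_ipderiv oO s (g := fun=> (i == j)%:R))//; last first.
  by move=> y _; rewrite pderiv_coord.
rewrite ipderiv_cst// size_rcons; case: s => [|k s] /=.
  by case: (i == j); rewrite ?normr1 ?normr0.
by rewrite normr0 nth_nil.
Qed.

(** An affine factor leaves only two Leibniz terms, and k (k-1)! = k! makes their sum exactly
    [d + A^-1] times the old bound. The product costs a factor in [B] and nothing in [A], so it can
    be iterated over a monomial. *)
Lemma geom_bounded_coordM A B (d : R) (j : 'I_n) (c : R) f : 0 < A -> 0 <= d ->
  (forall x, O x -> `|x 0 j - c| <= d) -> geom_bounded A B f ->
  geom_bounded A ((d + A^-1) * B) (fun x => (x 0 j - c) * f x).
Proof.
move=> A0 d0 Od [sf bf]; split.
  by move=> k; apply: smoothkM => //; exact: smoothk_coord.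
move=> s x Ox; have B0 : 0 <= B.
  by have := bf [::] x Ox; rewrite expr0 !mulr1; exact: le_trans.
apply: le_trans (leibniz_bound (a := nth 0 [:: d; 1])
  (b := fun q => B * A ^+ q * q`!%:R) oO Ox _ sf _ _) _.
- by move=> k; exact: smoothk_coord.
- by move=> t _; apply: ipderiv_coord_bound => //; exact: Od.
- by move=> t _; exact: bf.
case: (size s) => [|k].
  rewrite big_ord_recl big_ord0 addr0 /= !expr0 fact0 !mulr1 mul1r ler_wpM2r//.
  by rewrite lerDl invr_ge0 ltW.
rewrite 2!big_ord_recl /= big1 ?addr0; last first.
  by move=> q _; rewrite /bump /= !add1n /= nth_nil mulr0 mul0r.
rewrite bin0 /bump /= add1n bin1 subn0 subSS subn0 mul1r mulr1.
rewrite factS natrM exprS le_eqVlt; apply/orP; left; apply/eqP; field.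
by rewrite gt_eqF.
Qed.

Lemma geom_boundedZ A B c f : geom_bounded A B f ->
  geom_bounded A (`|c| * B) (fun x => c * f x).
Proof.
move=> [sf bf]; split; first by move=> k; apply: smoothkM => //; exact: smoothk_cst.
move=> s x Ox.
have -> : ipderiv s (fun x => c * f x) x = c * ipderiv s f x.
  elim: s x Ox => [//|i s IH x Ox].
  rewrite [LHS](eq_on_pderiv oO i IH Ox).
  exact: deriveZ (smoothk_derivable (smoothk_ipderiv s sf (k := 0%N)) Ox).
by rewrite normrM -!mulrA ler_wpM2l// mulrA; exact: bf.
Qed.

Lemma geom_bounded_sum A (I : Type) (r : seq I) (P : pred I) (B : I -> R)
    (f : I -> 'rV[R]_n -> R) : (forall i, P i -> geom_bounded A (B i) (f i)) ->
  geom_bounded A (\sum_(i <- r | P i) B i) (fun x => \sum_(i <- r | P i) f i x).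
Proof.
move=> bf; split.
  by move=> k; apply: smoothk_sum => // i /bf[sf _]; exact: sf.
move=> s x Ox; rewrite (ipderiv_sum oO)//; last by move=> i k /bf[sf _]; exact: sf.
apply: (le_trans (ler_norm_sum _ _ _)); rewrite !mulr_suml.
by apply: ler_sum => i /bf[_]; exact.
Qed.

Lemma geom_bounded_mono A d (a : mindex n) (x0 : 'rV[R]_n) : 0 < A -> 0 <= d ->
  (forall x j, O x -> `|x 0 j - x0 0 j| <= d) ->
  geom_bounded A ((d + A^-1) ^+ mlen a) (fun x => mono a x x0).
Proof.
move=> A0 d0 Od; rewrite /mono /mlen.
elim: (index_enum _) => [|i r IH].
  rewrite big_nil expr0; have := geom_bounded_cst 1 (ltW A0); rewrite normr1.
  by apply: geom_bounded_eq => x _; rewrite big_nil.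
rewrite big_cons.
suff H m : geom_bounded A ((d + A^-1) ^+ (m + \sum_(j <- r) a j))
    (fun x => (x 0 i - x0 0 i) ^+ m * \prod_(j <- r) (x 0 j - x0 0 j) ^+ a j).
  by apply: geom_bounded_eq (H (a i)) => x _; rewrite big_cons.
elim: m => [|m IHm].
  by rewrite add0n; apply: geom_bounded_eq IH => x _; rewrite expr0 mul1r.
rewrite addSn exprS.
have := geom_bounded_coordM A0 d0 (fun x => Od x i) IHm.
by apply: geom_bounded_eq => x _; rewrite exprS mulrA.
Qed.

(** At [x0 + const_mx 1] all monomials equal 1, so [abs_hom_part] there is the sum of the absolute
    values of the coefficients of degree [k]. *)
Lemma geom_bounded_hom_part A d (c : mindex n -> R) (x0 : 'rV[R]_n) k :
  0 < A -> 0 <= d -> (forall x j, O x -> `|x 0 j - x0 0 j| <= d) ->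
  geom_bounded A (abs_hom_part c x0 (x0 + const_mx 1) k * (d + A^-1) ^+ k)
   (fun x => hom_part c x0 x k).
Proof.
move=> A0 d0 Od; rewrite /abs_hom_part /hom_part mulr_suml.
apply: geom_bounded_sum => b /eqP bk.
have -> : mono [ffun i => b i : nat] (x0 + const_mx 1) x0 = 1.
  by rewrite /mono big1// => i _; rewrite !mxE addrAC subrr add0r expr1n.
rewrite normr1 mulr1; apply: geom_boundedZ.
have := geom_bounded_mono [ffun i => b i : nat] A0 d0 Od.
by rewrite /mlen (eq_bigr (fun i => b i : nat)) ?bk// => i _; rewrite ffunE.
Qed.

End GeomBounded.

(** * Cauchy estimates for real analytic functions *)

Section Analytic.
Variables (R : realType) (n : nat).

Lemma abs_hom_part_scale (c : mindex n -> R) (x0 : 'rV[R]_n) (r : R) k : 0 <= r ->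
  abs_hom_part c x0 (x0 + const_mx r) k = abs_hom_part c x0 (x0 + const_mx 1) k * r ^+ k.
Proof.
move=> r0; rewrite /abs_hom_part mulr_suml; apply: eq_bigr => b /eqP bk.
rewrite -mulrA; congr (_ * _); rewrite /mono.
rewrite (eq_bigr (fun i => r ^+ b i)); last first.
  by move=> i _; rewrite !mxE addrAC subrr add0r ffunE.
rewrite [X in _ = `|X| * _]big1; last first.
  by move=> i _; rewrite !mxE addrAC subrr add0r expr1n.
by rewrite normr1 mul1r prodrXr ?bk ger0_norm// exprn_ge0.
Qed.

Lemma analytic_at_geom_bounded (f : 'rV[R]_n -> R) (x0 : 'rV[R]_n) : analytic_at f x0 ->
  exists d A B : R, [/\ 0 < d, 0 <= A, 0 <= B & geom_bounded (ball x0 d) A B f].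
Proof.
move=> [c [r [r0 cf]]].
pose r' := r / 2; have r'0 : 0 < r' by rewrite divr_gt0.
have r'r : r' < r by rewrite /r' ltr_pdivrMr// ltr_pMr// ltr1n.
(* On the diagonal every monomial of degree k has absolute value [r' ^+ k], so a single point bounds
   all the coefficient sums. *)
have [|[B0 hB0] _] := cf (x0 + const_mx r').
  apply/ball_rVP => // i; rewrite !mxE opprD addNKr normrN gtr0_norm//.
pose P k := abs_hom_part c x0 (x0 + const_mx 1) k.
have P0 k : 0 <= P k by rewrite sumr_ge0// => b _; rewrite mulr_ge0.
have PB k : P k * r' ^+ k <= B0.
  apply: le_trans (hB0 k.+1); rewrite big_ord_recr /= (abs_hom_part_scale _ _ _ (ltW r'0)).
  rewrite lerDr sumr_ge0// => i _; rewrite (abs_hom_part_scale _ _ _ (ltW r'0)).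
  by rewrite mulr_ge0// exprn_ge0// ltW.
have B00 : 0 <= B0 by apply: le_trans (PB 0%N); rewrite mulr1.
(* With [A = d^-1] one gets [d + A^-1 = r' / 2], so the k-th homogeneous part is bounded with
   constant [B0 * 2^-1 ^+ k], whose sum is at most [2 * B0]. *)
pose d := r' / 4; have d0 : 0 < d by rewrite divr_gt0.
have dr : d < r by apply: le_lt_trans r'r; rewrite ler_pdivrMr// (ler_peMr (ltW r'0))// ler1n.
pose A := d^-1; have A0 : 0 < A by rewrite invr_gt0.
have oO : open (ball x0 d) by exact: ball_open.
have Od x j : ball x0 d x -> `|x 0 j - x0 0 j| <= d.
  by move=> /ball_rVP => /(_ d0 j); rewrite distrC => /ltW.
pose S N x := \sum_(k < N) hom_part c x0 x k.
have gS k : geom_bounded (ball x0 d) A (B0 * 2^-1 ^+ k) (fun x => hom_part c x0 x k).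
  have [sg bg] := geom_bounded_hom_part oO c k A0 (ltW d0) Od.
  split => // s x Ox; apply: (le_trans (bg s x Ox)).
  rewrite -[leLHS]mulrA -[leRHS]mulrA; apply: ler_wpM2r.
    by rewrite mulr_ge0// exprn_ge0// ltW.
  apply: le_trans (ler_wpM2r _ (PB k)); last by rewrite exprn_ge0.
  rewrite -mulrA ler_wpM2l// -exprMn /A invrK le_eqVlt; apply/orP; left; apply/eqP.
  by congr (_ ^+ k); rewrite /d; field.
have geom N : \sum_(k < N) B0 * 2^-1 ^+ k <= B0 * 2.
  have := @geometric_le_lim R N B0 2^-1 B00; rewrite /series /= big_mkord => H.
  apply: le_trans (H _ _) _; rewrite ?invr_gt0// ?ger0_norm ?invr_ge0//.
    by rewrite invf_lt1// ltr1n.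
  by rewrite le_eqVlt; apply/orP; left; apply/eqP; field.
have Sf : bounded_cvg (ball x0 d) S f (fun s => B0 * 2 * A ^+ size s * (size s)`!%:R).
  have gSN N := geom_bounded_sum oO (index_enum 'I_N) (P := xpredT) (fun (k : 'I_N) _ => gS k).
  split.
  - by move=> N k; have [sN _] := gSN N; exact: sN.
  - move=> N s x Ox; have [_ bN] := gSN N; apply: (le_trans (bN s x Ox)).
    rewrite -[leLHS]mulrA -[leRHS]mulrA.
    by rewrite ler_wpM2r ?geom// mulr_ge0// exprn_ge0// ltW.
  - move=> s x Ox.
    pose u k := ipderiv s (fun x => hom_part c x0 x k) x.
    have -> : (fun N => ipderiv s (S N) x) = series u.
      apply/funext => N; rewrite /S (ipderiv_sum oO)//; last first.
        by move=> k l _; have [sk _] := gS k; exact: sk.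
      by rewrite /series /= big_mkord.
    apply: normed_cvg; apply: nondecreasing_is_cvgn.
      by apply/nondecreasing_seqP => N; rewrite /= /series /= big_nat_recr//= lerDl.
    exists (B0 * 2 * A ^+ size s * (size s)`!%:R) => _ [N _ <-].
    rewrite /= /series /= big_mkord.
    apply: (@le_trans _ _ (\sum_(k < N) (B0 * 2^-1 ^+ k) * (A ^+ size s * (size s)`!%:R))).
      by apply: ler_sum => k _; rewrite mulrA; have [_] := gS k; exact.
    rewrite -mulr_suml -[leRHS]mulrA; apply: ler_wpM2r; last exact: geom.
    by rewrite mulr_ge0// exprn_ge0// ltW.
  - move=> x Ox; have [|_ C] := cf x; last exact: C.
    exact: (le_ball (ltW dr) Ox).
exists d, A, (B0 * 2); split => //; [exact: ltW|by rewrite mulr_ge0|].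
by have [sf bf] := bounded_cvg_smooth oO Sf.
Qed.

End Analytic.

(** * Pullback *)

Section MultiIndex.
Variables (R : realType) (n : nat).

Definition seq_of_mindex (a : mindex n) : seq 'I_n :=
  flatten [seq nseq (a i) i | i <- enum 'I_n].

Lemma dalpha_ipderiv (a : mindex n) (f : 'rV[R]_n -> R) :
  dalpha a f = ipderiv (seq_of_mindex a) f.
Proof.
rewrite /dalpha /seq_of_mindex; elim: (enum _) => [//|i r IH].
rewrite [LHS]/= IH [flatten _]/= ipderiv_cat; elim: (a i) => [//|m IHm].
by rewrite [LHS]/= IHm.
Qed.

Lemma count_seq_of_mindex (a : mindex n) i : count_mem i (seq_of_mindex a) = a i.
Proof.
rewrite /seq_of_mindex count_flatten -map_comp sumnE big_map big_enum /=.
rewrite (bigD1 i)//= count_nseq /= eqxx mul1n big1 ?addn0// => j ji.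
by rewrite count_nseq /= (negbTE ji).
Qed.

Lemma size_seq_of_mindex (a : mindex n) : size (seq_of_mindex a) = mlen a.
Proof.
rewrite /seq_of_mindex size_flatten /shape -map_comp sumnE big_map big_enum /=.
by apply: eq_bigr => i _; rewrite size_nseq.
Qed.

Lemma perm_seq_of_mindex (s : seq 'I_n) :
  perm_eq s (seq_of_mindex [ffun i => count_mem i s]).
Proof. by apply/allP => i _; rewrite /= count_seq_of_mindex ffunE. Qed.

End MultiIndex.

(** * Relatively compact neighborhoods *)

Section Topology.
Variable R : realType.

Lemma rel_compact_neighborhood n (K O : set 'rV[R]_n) : open O -> compact K ->
  K `<=` O -> exists2 V, rel_compact_open_in V O & K `<=` V.
Proof.
move=> oO cK KO.
have [d d0 dO] : exists2 d : R, 0 < d & forall y, K y -> ball y d `<=` O.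
  (* Radii [i.+1%:R^-1] turn the search for a uniform radius into a statement about large [i], to
     which the covering form of compactness applies. *)
  have : \forall i \near \oo, K `<=` (fun y => ball y (i.+1%:R^-1 : R) `<=` O).
    apply: (iffLR (compact_near_coveringP K) cK) => y Ky.
    have /nbhs_ballP[r /= r0 rO] : nbhs y O by apply: open_nbhs_nbhs; split => //; exact: KO.
    exists (ball y (r / 2), [set i | (i.+1%:R^-1 : R) < r / 2]).
      split; first by apply: nbhsx_ballx; rewrite divr_gt0.
      by apply: near_infty_natSinv_lt (PosNum (divr_gt0 r0 (ltr0n _ 2))).
    move=> [y' i] /= [yy' ir] z yz; apply: rO; rewrite [r]splitr.
    by apply: ball_triangle yy' _; exact: le_ball (ltW ir) _ yz.
  by move=> [i _ /(_ i (leqnn _))] H; exists (i.+1%:R^-1); rewrite ?invr_gt0.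
pose V := \bigcup_(y in K) ball y (d / 2).
have clV z : closure V z -> exists2 y, K y & ball y d z.
  move=> /(_ (ball z (d / 2))) [|w [[y Ky yw] zw]].
    by apply: nbhsx_ballx; rewrite divr_gt0.
  by exists y => //; rewrite [d]splitr; apply: ball_triangle yw _; exact: ball_sym.
exists V; last by move=> y Ky; exists y => //; apply: ballxx; rewrite divr_gt0.
split; first by apply: bigcup_open => y _; apply: ball_open; rewrite divr_gt0.
- apply: bounded_closed_compact; last exact: closed_closure.
  have [M [_ MK]] := compact_bounded cK.
  exists (M + 1 + d); split; first exact: num_real.
  move=> x Mx z /clV[y Ky]; rewrite -ball_normE /= => yz; apply: le_trans (ltW Mx).
  rewrite -[z](subKr y) (le_trans (ler_normB _ _))//.
  by apply: lerD; [apply: MK => //; rewrite ltrDl|rewrite ltW].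
- by move=> z /clV[y Ky yz]; exact: dO Ky _ yz.
Qed.

End Topology.

Section RealAnalytic.
Variables (R : realType) (n : nat) (O : set 'rV[R]_n).

Lemma real_analytic_smoothk (f : 'rV[R]_n -> R) k : real_analytic_on O f -> smoothk O k f.
Proof.
move=> af s x sk Ox; have [d [A [B [d0 _ _ [sf _]]]]] := analytic_at_geom_bounded (af x Ox).
by apply: (sf k) => //; exact: ballxx.
Qed.

(** The local estimates weaken as their constants grow, so one large integer can serve as both
    constants near each point; compactness and the finite number of components make it uniform. *)
Lemma real_analytic_compact_bound m (F : 'rV[R]_n -> 'rV[R]_m) (K : set 'rV[R]_n) :
  real_analytic_map_on O F -> compact K -> K `<=` O ->
  exists2 A : R, 0 < A & forall x s j, K x ->
    `|ipderiv s (fun x => F x 0 j) x| <= A * A ^+ size s * (size s)`!%:R.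
Proof.
move=> aF cK KO.
have [i _ Hi] : \forall i \near \oo, forall j, K `<=` (fun x => forall s,
    `|ipderiv s (fun x => F x 0 j) x| <= i%:R * i%:R ^+ size s * (size s)`!%:R).
  apply: filter_forall => j.
  apply: (iffLR (compact_near_coveringP K) cK) => x Kx.
  have [d [A [B [d0 A0 B0 [_ bF]]]]] := analytic_at_geom_bounded (aF j x (KO x Kx)).
  exists (ball x d, [set i | Num.max A B <= i%:R]).
    by split; [exact: nbhsx_ballx|exact: nbhs_infty_ger].
  move=> [y i] /= [xy]; rewrite ge_max => /andP[Ai Bi] s.
  apply: (le_trans (bF s y xy)); rewrite ler_wpM2r//.
  by apply: ler_pM => //; rewrite ?exprn_ge0// lerXn2r ?nnegrE.
exists i.+1%:R => // x s j Kx; exact: (Hi i.+1 (leqnSn i) j x Kx s).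
Qed.

End RealAnalytic.

Section Pullback.
Variables (R : realType) (n1 n2 : nat) (V1 : set 'rV[R]_n1) (V2 : set 'rV[R]_n2).
Variables (F : 'rV[R]_n1 -> 'rV[R]_n2) (A : R) (M : nat -> R).
Hypotheses (oV1 : open V1) (oV2 : open V2) (FV : forall x, V1 x -> V2 (F x)).
Hypothesis sF : forall j k, smoothk V1 k (fun x => F x 0 j).
Hypotheses (A0 : 0 < A) (bF : forall x s j, V1 x ->
  `|ipderiv s (fun x => F x 0 j) x| <= A * A ^+ size s * (size s)`!%:R).
Hypotheses (wM : weight_sequence M)
  (mM : (fun k : nat => small_m M k `^ (k%:R)^-1) @ \oo --> +oo).

(** The induction runs with [regularized M e]: the bound on [u] enters through [M <= N], and the
    result returns to [M] through [N <= D * M]. *)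
Lemma pullback_bound (u : 'rV[R]_n2 -> R) (rho e L C : R) :
  0 < rho -> 0 < e -> 0 < L -> 4 * e * A <= L -> 2 * n2%:R * A * A * rho <= L ->
  (forall k, smoothk V2 k u) ->
  (forall y a, V2 y -> `|dalpha a u y| / (rho ^+ mlen a * M (mlen a)) <= C) ->
  exists C', forall x a, V1 x ->
    `|dalpha a (u \o F) x| / (L ^+ mlen a * M (mlen a)) <= C'.
Proof.
move=> rho0 e0 L0 hL1 hL2 su ub.
have Mp k : 0 < M k.
  by have [Mk _] := weight_sequence_ge1 k wM; exact: lt_le_trans ltr01 Mk.
have [D D0 hD] := regularized_le e0 wM mM.
pose N := regularized M e.
have N0 m : 0 <= N m by rewrite (le_trans _ (regularized_ge M e m))// ltW.
exists (`|C| * D) => x a Vx.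
rewrite ler_pdivrMr ?mulr_gt0 ?exprn_gt0// dalpha_ipderiv -size_seq_of_mindex.
move: (seq_of_mindex a) => s.
have ut t : `|ipderiv t u (F x)| <= `|C| * rho ^+ size t * N (size t).
  have Fx := FV Vx.
  rewrite (perm_ipderiv oV2 su (perm_seq_of_mindex t) Fx) -dalpha_ipderiv.
  rewrite [in leRHS](perm_size (perm_seq_of_mindex t)) size_seq_of_mindex.
  have := ub _ [ffun i => count_mem i t] Fx.
  rewrite ler_pdivrMr ?mulr_gt0 ?exprn_gt0// => H; apply: (le_trans H).
  rewrite -[leRHS]mulrA; apply: (@le_trans _ _ (`|C| * (rho ^+ mlen _ * M (mlen _)))).
    apply: ler_wpM2r; last exact: ler_norm.
    by rewrite mulr_ge0 ?exprn_ge0// ltW.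
  rewrite ler_wpM2l// ler_wpM2l ?exprn_ge0 ?(ltW rho0)//; exact: regularized_ge.
have := comp_bound oV1 oV2 FV sF (ltW e0) N0 (fun m => regularized_growth M m e0)
  (normr_ge0 C) (ltW A0) (ltW A0) (ltW rho0) hL1 hL2 su Vx ut
  (fun s j => bF s j Vx) s [::].
rewrite /= expr0 mulr1 add0n => H; apply: (le_trans H).
rewrite -mulrA -[leRHS]mulrA ler_wpM2l// mulrCA ler_wpM2l ?exprn_ge0 ?(ltW L0)//.
Qed.

End Pullback.

Theorem theorem2p8 (R : realType) (W : set (nat -> R))
  (hW : weight_matrix W)
  (hm : forall M, W M -> (fun k : nat => small_m M k `^ (k%:R)^-1) @ \oo --> +oo)
  (n1 n2 : nat) (Omega1 : set 'rV[R]_n1) (Omega2 : set 'rV[R]_n2)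
  (hO1 : open Omega1) (hO2 : open Omega2)
  (F : 'rV[R]_n1 -> 'rV[R]_n2)
  (hF : real_analytic_map_on Omega1 F)
  (hFO : F @` Omega1 `<=` Omega2) :
  (forall u : 'rV[R]_n2 -> R,
     roumieu_class W Omega2 u -> roumieu_class W Omega1 (u \o F)) /\
  (forall u : 'rV[R]_n2 -> R,
     beurling_class W Omega2 u -> beurling_class W Omega1 (u \o F)).
Proof.
have FO x : Omega1 x -> Omega2 (F x) by move=> Ox; apply: hFO; exists x.
have sF j k : smoothk Omega1 k (fun x => F x 0 j) by exact: real_analytic_smoothk.
have smooth_comp u : smooth_on Omega2 u -> smooth_on Omega1 (u \o F).
  by move=> /smooth_smoothk su; apply/smooth_smoothk => k;
    exact (smoothk_comp hO1 hO2 FO sF su (k := k)).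
(* [V2] is a neighborhood of the compact image of the closure of [V]; this is where the bounds on
   [u] are requested. *)
have local V : rel_compact_open_in V Omega1 -> exists V2 A,
    [/\ rel_compact_open_in V2 Omega2, forall x, V x -> V2 (F x), 0 < A &
     forall x s j, V x ->
       `|ipderiv s (fun x => F x 0 j) x| <= A * A ^+ size s * (size s)`!%:R].
  move=> [oV cV VO].
  have cFV : compact (F @` closure V).
    apply: continuous_compact cV; apply: continuous_in_subspaceT => x.
    rewrite inE => /VO Ox; apply: rV_continuous => j.
    exact: smoothk_continuous (sF j 0%N) Ox.
  have [|V2 V2O KV2] := rel_compact_neighborhood hO2 cFV.
    by move=> _ [x /VO Ox <-]; exact: FO.
  have [A A0 bF] := real_analytic_compact_bound hF cV VO.
  exists V2, A; split => //.
    by move=> x Vx; apply: KV2; exists x => //; exact: subset_closure.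
  by move=> x s j Vx; apply: bF; exact: subset_closure.
have sub n k (V O : set 'rV[R]_n) f : V `<=` O -> smoothk O k f -> smoothk V k f.
  by move=> VO sf s x sk /VO; exact: sf.
have inO n (V O : set 'rV[R]_n) : rel_compact_open_in V O -> V `<=` O.
  by move=> [_ _ VO] x Vx; apply: VO; exact: subset_closure.
split=> u [su cu]; (split; first exact: smooth_comp); move=> V VO;
  have [V2 [A [V2O FV A0 bF]]] := local V VO;
  have [[oV _ _] [oV2 _ _]] := (VO, V2O);
  have sFV j k := sub _ k _ _ _ (inO _ _ _ VO) (sF j k);
  have suV k := sub _ k _ _ _ (inO _ _ _ V2O) ((smooth_smoothk _ _).1 su k).
- have [M [WM [rho [rho0 [C ub]]]]] := cu V2 V2O.
  exists M; split => //.
  (* The sum of the two lower bounds required of [L], with [e = 1]; the weight [M] supplied by [u]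
     on [V2] is kept. *)
  pose L := 4 * 1 * A + 2 * n2%:R * A * A * rho.
  have L1 : 0 < 4 * 1 * A by rewrite !mulr_gt0.
  have L2 : 0 <= 2 * n2%:R * A * A * rho by rewrite !mulr_ge0// ltW.
  have L0 : 0 < L by rewrite ltr_pwDl.
  exists L; split => //.
  by apply: (pullback_bound oV oV2 FV sFV A0 bF (hW.1 M WM) (hm M WM) rho0 ltr01 L0
    _ _ suV ub); rewrite /L ?lerDl ?lerDr// ltW.
- move=> M WM L L0.
  (* Now [L] is prescribed: this [e] makes the first condition an equality, and [rho = L / Q] gives
     the second. The 1 in [Q] avoids division by zero when [n2 = 0]. *)
  pose e := L / (4 * A); have e0 : 0 < e by rewrite divr_gt0// mulr_gt0.
  pose Q := 2 * n2%:R * A * A + 1.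
  have Q1 : 0 <= 2 * n2%:R * A * A by rewrite !mulr_ge0// ltW.
  have Q0 : 0 < Q by rewrite ltr_wpDl.
  pose rho := L / Q; have rho0 : 0 < rho by rewrite divr_gt0.
  have [C ub] := cu V2 V2O M WM rho rho0.
  apply: (pullback_bound oV oV2 FV sFV A0 bF (hW.1 M WM) (hm M WM) rho0 e0 L0
    _ _ suV ub).
    by rewrite le_eqVlt; apply/orP; left; apply/eqP; rewrite /e; field; rewrite gt_eqF.
  by rewrite /rho mulrA ler_pdivrMr// mulrC ler_wpM2l ?lerDl// ltW.
Qed.
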